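(* Let $1\le p<p'$ be coprime integers, let $1\le r\le p-1$ and $1\le b,s\le p'-1$, put $\lambda=|b-s|$, and let $N\ge 1$, $k\ge 0$ and $0\le \ell<N$ be integers such that $\ell+\lambda+N(kb+b-r)$ is even. Let $\sigma\in\{0,1\}$ with $\sigma\equiv kb+b-r \pmod 2$. Let $\alpha^{(k)}=\{\alpha^{(k)}_L\}_{L\ge0}$ be the $\alpha$-sequence of the ($k$ times iterated) dual Bailey pair relative to $q^{\lambda}$ coming from the $M(p,p')$ polynomials, as defined in the context. Then $$\frac{1}{(q)_\infty}\sum_{L=0}^{\infty}q^{L(L+\lambda)/N}\,\alpha^{(k)}_L\sum_{\substack{\eta\in\mathbb{Z}_{\ge0}^{N-1}\\ \frac{L+(\lambda-\ell)/2}{N}-(C^{-1}\eta)_1\in\mathbb{Z}+\frac{\sigma}{2}}}\frac{q^{\eta^{T}C^{-1}(\eta-e_\ell)}}{(q)_{\eta_1}\cdots(q)_{\eta_{N-1}}}=\hat\chi^{(p',\,p'+N(kp'+p'-p);\,N)}_{s,\;b+N(kb+b-r);\;\ell}(q).$$ That is, there is a (dual) Bailey flow $M(p,p')=(p,p')_1\to (p',p'+N(kp'+p'-p))_N$.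
   Context: Notation: $(q)_n=\prod_{i=1}^n(1-q^i)$, $(q)_\infty=\prod_{i\ge1}(1-q^i)$; all identities are between formal series in (fractional powers of) $q$. $C$ is the Cartan matrix of $A_{N-1}$, $C_{ij}=2\delta_{ij}-\delta_{|i-j|,1}$, $1\le i,j\le N-1$, so $(C^{-1})_{ij}=\min\{i,j\}-ij/N$. $e_i$ is the $i$-th unit vector in $\mathbb{Z}^{N-1}$ and $e_i=0$ for $i\notin\{1,\dots,N-1\}$. For $N=1$ the sums over vectors have just the empty vector, with $(C^{-1}\eta)_1=0$. The sequence $\alpha^{(k)}$ (terms whose positions coincide are added), with the abbreviation $w=kp'+p'-p$: $$\alpha^{(k)}_L=\delta_{L,0}+\sum_{j\ge1}\Bigl(q^{j(jp'w+p'(kb+b-r)-sw)}\delta_{L,\,jp'-(\lambda-b+s)/2}+q^{j(jp'w-p'(kb+b-r)+sw)}\delta_{L,\,jp'-(\lambda+b-s)/2}\Bigr)$$ $$-\sum_{j\ge0}q^{(jp'+s)(jw+kb+b-r)}\delta_{L,\,jp'-(\lambda-b-s)/2}-\sum_{j\ge1}q^{(jp'-s)(jw-kb-b+r)}\delta_{L,\,jp'-(\lambda+b+s)/2}.$$ Level-$N$ $A_1^{(1)}$ string functions ($0\le\ell\le N$, $m+\ell$ even): $$c^\ell_m(q)=\frac{q^{\frac{\ell(N-\ell)}{2N(N+2)}}}{(q)_\infty}\sum_{\substack{n\in\mathbb{Z}_{\ge0}^{N-1}\\ \frac{m+\ell}{2N}+(C^{-1}n)_1\in\mathbb{Z}}}\frac{q^{n^TC^{-1}(n-e_\ell)}}{(q)_{n_1}\cdots(q)_{n_{N-1}}};$$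 they satisfy $c^\ell_m=c^\ell_{-m}=c^\ell_{m+2N}=c^{N-\ell}_{N-m}$. The coset $(P,P')_N$ denotes $(A^{(1)}_1)_N\times(A_1^{(1)})_{N'}/(A^{(1)}_1)_{N+N'}$ with $N'=NP/(P'-P)-2$, where $P<P'$, $P'-P\equiv0\bmod N$, $\gcd((P'-P)/N,P')=1$; $M(p,p')=(p,p')_1$ is the minimal model. Its normalized branching functions are, for $R,S,\ell$ with $0\le\ell\le N$ and $R-S\equiv\ell\bmod 2$, given by $$\hat\chi^{(P,P';N)}_{R,S;\ell}(q)=q^{-\frac{\ell(N-\ell)}{2N(N+2)}}\sum_{0\le m\le N/2}c^\ell_{2m}(q)\Biggl(\sum_{\substack{j\in\mathbb{Z}\\ \mu_{R-S}(j)\equiv\pm m\bmod N}}q^{\frac jN(jPP'+P'R-PS)}-\sum_{\substack{j\in\mathbb{Z}\\ \mu_{R+S}(j)\equiv\pm m\bmod N}}q^{\frac1N(jP'+S)(jP+R)}\Biggr),$$ where $\mu_a(j)=a/2+P'j$ and $m$ runs over integers if $\ell$ is even and over half-odd-integers if $\ell$ is odd (this formula is taken as the definition for all integers $R,S$ occurring in the claim). *)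

(* Defs.v *)
From mathcomp Require Import all_boot all_order all_algebra.
From mathcomp Require Import boolp classical_sets functions cardinality fsbigop.

Set Implicit Arguments.
Unset Strict Implicit.
Unset Printing Implicit Defensive.

Import Order.TTheory GRing.Theory Num.Theory.
Local Open Scope classical_set_scope.
Local Open Scope ring_scope.

(* A formal series in fractional powers of q is given by its coefficients:
   [f x] is the coefficient of q^x.  Sums [\sum_(i \in A)] are the finite-support
   sums of fsbigop, so infinite sums and products of series are computed
   coefficientwise; in every use below each coefficient receives only finitely
   many nonzero contributions (exponents are bounded below and their growth in
   the summation variables is positive definite quadratic). *)
Definition qseries := rat -> int.

Definition qmon (c : int) (e : rat) : qseries := fun x => if x == e then c else 0.

Definition qmul (f g : qseries) : qseries :=
  fun x => \sum_(y \in [set: rat]) f y * g (x - y).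

Definition qsum (I : choiceType) (A : set I) (F : I -> qseries) : qseries :=
  fun x => \sum_(i \in A) F i x.

Definition qpoch (n : nat) : {poly int} := \prod_(1 <= i < n.+1) (1 - 'X^i).

(* (q)_oo agrees with (q)_m up to and including degree m. *)
Definition qpoch_oo (m : nat) : int := (qpoch m)`_m.

(* The inverse 1 / a = \sum_k (1 - a)^k of an integral power series a with
   a 0 = 1; the terms with k > m do not contribute in degree m. *)
Definition ps_inv (a : nat -> int) (m : nat) : int :=
  (\sum_(k < m.+1) (1 - \poly_(i < m.+1) a i) ^+ k)`_m.

Definition q_of_ps (a : nat -> int) : qseries :=
  qsum [set: nat] (fun m => qmon (a m) m%:R).

Definition inv_qpoch_oo : qseries := q_of_ps (ps_inv qpoch_oo).

Definition delta (x y : rat) : int := (x == y)%:R.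

Definition alpha (p p' r b s k : int) (L : nat) : qseries :=
  let w := k * p' + p' - p in
  let t := k * b + b - r in
  let lambda := `|b - s| in
  qmon (delta L%:R 0) 0
  \+ qsum [set j : int | 1 <= j] (fun j =>
       qmon (delta L%:R ((j * p')%:~R - (lambda - b + s)%:~R / 2))
            (j * (j * p' * w + p' * t - s * w))%:~R
       \+ qmon (delta L%:R ((j * p')%:~R - (lambda + b - s)%:~R / 2))
               (j * (j * p' * w - p' * t + s * w))%:~R)
  \- qsum [set j : int | 0 <= j] (fun j =>
       qmon (delta L%:R ((j * p')%:~R - (lambda - b - s)%:~R / 2))
            ((j * p' + s) * (j * w + t))%:~R)
  \- qsum [set j : int | 1 <= j] (fun j =>
       qmon (delta L%:R ((j * p')%:~R - (lambda + b + s)%:~R / 2))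
            ((j * p' - s) * (j * w - t))%:~R).

(* Coordinate j : 'I_(N.-1) carries the index j + 1 of the range 1, ..., N - 1. *)
Definition cartan (N : nat) : 'M[rat]_(N.-1) :=
  \matrix_(i, j) (2 * (i == j)%:R - ((i.+1 == j :> nat) || (j.+1 == i :> nat))%:R).

(* e_i, which is 0 unless 1 <= i <= N - 1 *)
Definition unitv (N i : nat) : 'cV[rat]_(N.-1) := \col_j (j.+1 == i :> nat)%:R.

Definition Cform (N : nat) (u v : 'cV[rat]_(N.-1)) : rat :=
  (u^T *m invmx (cartan N) *m v) ord0 ord0.

Definition ratv (N : nat) (n : 'cV[nat]_(N.-1)) : 'cV[rat]_(N.-1) :=
  map_mx (fun k : nat => k%:R) n.

(* (C^-1 n)_1 = e_1^T C^-1 n; it is 0 when N = 1. *)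
Definition Cinv1 (N : nat) (n : 'cV[nat]_(N.-1)) : rat := Cform (unitv N 1) (ratv n).

Definition fermi_term (N l : nat) (n : 'cV[nat]_(N.-1)) : qseries :=
  qmul (qmon 1 (Cform (ratv n) (ratv n - unitv N l)))
       (q_of_ps (ps_inv (fun m => (\prod_(i < N.-1) qpoch (n i ord0))`_m))).

(* The formula is meant for l <= N and m + l even. *)
Definition stringf (N l : nat) (m : int) : qseries :=
  qmul (qmon 1 ((l * (N - l))%N%:R / (2 * N * (N + 2))%N%:R))
    (qmul inv_qpoch_oo
      (qsum [set n : 'cV[nat]_(N.-1) |
               (m + l%:Z)%:~R / (2 * N)%N%:R + Cinv1 n \is a Num.int]
            (@fermi_term N l))).

Definition eqmodN (N : nat) (x y : rat) : bool := (x - y) / N%:R \is a Num.int.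

(* The sum over m in Z + l/2 with 0 <= m <= N/2 is indexed by M = 2m.  A j that
   satisfies both congruences mu = m and mu = - m counts once. *)
Definition branching (P P' : int) (N : nat) (R S : int) (l : nat) : qseries :=
  let mu (a j : int) : rat := a%:~R / 2 + (P' * j)%:~R in
  let J (a : int) (m : rat) : set int :=
    [set j | eqmodN N (mu a j) m \/ eqmodN N (mu a j) (- m)] in
  qmul (qmon 1 (- ((l * (N - l))%N%:R / (2 * N * (N + 2))%N%:R)))
    (qsum [set M : nat | (M <= N)%N /\ odd M = odd l] (fun M =>
      qmul (stringf N l M%:Z)
        (qsum (J (R - S) (M%:R / 2)) (fun j =>
           qmon 1 (j%:~R / N%:R * (j * P * P' + P' * R - P * S)%:~R))
         \- qsum (J (R + S) (M%:R / 2)) (fun j =>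
           qmon 1 (N%:R^-1 * ((j * P' + S) * (j * P + R))%:~R))))).

(* Main.v *)
Require Import Defs.
From mathcomp Require Import all_boot all_order all_algebra.
From mathcomp Require Import boolp classical_sets functions cardinality fsbigop.
From mathcomp Require Import ring lra zify.

Import Order.TTheory GRing.Theory Num.Theory.
Local Open Scope classical_set_scope.
Local Open Scope ring_scope.

(** Both sides are theta-like sums over all integers [j].  The four families of
the sequence alpha merge into two families indexed by Z, with positions [L]
given by [2 L + lambda = |2 j p' + s -+ b|]; completing the square in
[L (L + lambda) / N] turns their exponents into those of the branching function.
It remains to match the fermionic sums that multiply a given power of q, and they
agree because of the symmetry [c^l_m = c^l_{-m}], which is invisible in the
fermionic form and is the only nontrivial input.

Symmetry.  Let [N = n + 1] and, for a bit string [S] of length [N] with [N - l]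
ones, let [A] and [D] be the indicator vectors of its ascents 01 and descents 10.
Put [z_j = q^(m_j + ... + m_n)].  Peeling off the first letter gives
  [sum_S (prod_(j in S) z_j) (prod_(i in A) (1 - q^(m_i))) = z_(l+1) ... z_N].
Inserting this into the sum for [l] cancels the factors [1 - q^(m_i)] against
[1 / (q)_m], and the shift [m -> m + A] yields a sum over [S] and [m] of
[q^((m + A) C^-1 (m + D)) / (q)_m].  Reversing both [S] and [m] exchanges [A]
and [D], hence preserves each term, and it maps the class [a] of [sum_i i m_i]
modulo [N], taken before the shift, to [l - a]. *)

(** * Series *)

(** A finite-support sum defaults to [0] on an infinite support, so the joint support is required to
    be finite. Both index sets then shrink to its projections, where the exchange is that of finite
    sums. *)
Lemma exchange_fsum {I J : choiceType} (P : set I) (Q : set J) (f : I -> J -> int) :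
  finite_set [set u : I * J | [/\ P u.1, Q u.2 & f u.1 u.2 != 0]] ->
  \sum_(i \in P) \sum_(j \in Q) f i j = \sum_(j \in Q) \sum_(i \in P) f i j.
Proof.
set W := [set u | _] => finW.
pose P' := fst @` W; pose Q' := snd @` W.
have finP : finite_set P' by apply: finite_image.
have finQ : finite_set Q' by apply: finite_image.
have PP : P' `<=` P by move=> _ [u [Pu _ _] <-].
have QQ : Q' `<=` Q by move=> _ [u [_ Qu _] <-].
have out i j : P i -> Q j -> ~ (P' i /\ Q' j) -> f i j = 0.
  move=> Pi Qj nPQ; apply/eqP/negPn/negP => fn0; apply: nPQ.
  by split; exists (i, j).
have shrinkl j : Q j -> \sum_(i \in P') f i j = \sum_(i \in P) f i j.
  move=> Qj; apply: fsbig_widen => // i [Pi nPi]; apply: out => //; tauto.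
have shrinkr i : P i -> \sum_(j \in Q') f i j = \sum_(j \in Q) f i j.
  move=> Pi; apply: fsbig_widen => // j [Qj nQj]; apply: out => //; tauto.
transitivity (\sum_(i \in P') \sum_(j \in Q') f i j).
  rewrite -[LHS](@fsbig_widen _ _ _ _ P' P).
  - by apply: eq_fsbigr => i /set_mem/PP /shrinkr ->.
  - exact: PP.
  - move=> i [Pi nPi]; apply: fsbig1 => j Qj; apply: out => //; tauto.
rewrite exchange_fsbig//.
rewrite -[RHS](@fsbig_widen _ _ _ _ Q' Q).
- by apply: eq_fsbigr => j /set_mem/QQ /shrinkl.
- exact: QQ.
- move=> j [Qj nQj]; apply: fsbig1 => i Pi; apply: out => //; tauto.
Qed.

(** Each [j] lies in a single fibre, so the pairs that contribute are of the form [(h j, j)] with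
    [f j != 0], and the two sums may be exchanged. *)
Lemma fsum_fibers {I J : choiceType} (A : set I) (h : J -> I) (f : J -> int) :
  (forall j, A (h j)) -> finite_set [set j | f j != 0] ->
  \sum_(i \in A) \sum_(j \in [set j | h j = i]) f j = \sum_(j \in [set: J]) f j.
Proof.
move=> Ah fin.
transitivity (\sum_(i \in A) \sum_(j \in [set: J]) if h j == i then f j else 0).
  apply: eq_fsbigr => i _; rewrite fsbig_mkcond; apply: eq_fsbigr => j _.
  rewrite /patch; congr (if _ then _ else _).
  by apply/idP/eqP => [/set_mem//|hj]; apply/mem_set.
rewrite exchange_fsum.
  apply: eq_fsbigr => j _.
  rewrite -(@fsbig_widen _ _ _ _ [set h j]).
  - by rewrite fsbig_set1 eqxx.
  - by move=> _ ->; apply: Ah.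
  - by move=> i [_ /= /eqP]; rewrite eq_sym => /negbTE ->.
apply: (@sub_finite_set _ _ ((fun j => (h j, j)) @` [set j | f j != 0])).
  move=> [i j] /= [_ _]; case: (h j =P i) => [<- fj|_ /eqP/=] //.
  by exists j.
exact: finite_image.
Qed.

Lemma fsumB {J : choiceType} (A : set J) (f g : J -> int) :
  finite_set [set j | A j /\ f j != 0] -> finite_set [set j | A j /\ g j != 0] ->
  \sum_(j \in A) (f j - g j) = \sum_(j \in A) f j - \sum_(j \in A) g j.
Proof.
move=> ff fg; set B := [set j | A j /\ f j != 0] `|` [set j | A j /\ g j != 0].
have BA : B `<=` A by move=> j [[]|[]].
have finB : finite_set B by rewrite finite_setU.
have out j : A j -> ~ B j -> f j = 0 /\ g j = 0.
  move=> Aj nB; split; apply/eqP/negPn/negP => h; apply: nB; [by left|by right].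
rewrite -!(@fsbig_widen _ _ _ _ B A)//.
- rewrite fsbig_split//; congr (_ + _).
  by rewrite !fsbig_finite//= sumrN.
- by move=> j [Aj /(out _ Aj)[_ h]].
- by move=> j [Aj /(out _ Aj)[h _]].
- by move=> j [Aj /(out _ Aj)[h h']] /=; rewrite h h' subr0.
Qed.

Lemma fsum_neq0 {J : choiceType} (A : set J) (f : J -> int) :
  \sum_(j \in A) f j != 0 -> exists2 j, A j & f j != 0.
Proof. exact: (@fsbigN1 _ _ _ unit J A (fun=> f) tt). Qed.

Lemma qmul_neq0 f g x : qmul f g x != 0 -> exists2 y, f y != 0 & g (x - y) != 0.
Proof.
by case/fsum_neq0 => y _; rewrite mulf_eq0 negb_or => /andP[fy gy]; exists y.
Qed.

Lemma qmonE c e x : qmon c e x = if x == e then c else 0.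
Proof. by []. Qed.

Lemma qmulC f g : qmul f g = qmul g f.
Proof.
apply/funext => x; rewrite /qmul (reindex_fsbigT (fun y => x - y)).
  by apply: eq_fsbigr => y _; rewrite subKr mulrC.
by exists (fun y => x - y) => y; ring.
Qed.

Lemma qmul_qmon c e f x : qmul (qmon c e) f x = c * f (x - e).
Proof.
rewrite /qmul -(@fsbig_widen _ _ _ _ [set e])//.
  by rewrite fsbig_set1 qmonE eqxx.
by move=> y [_ /= /eqP/negbTE]; rewrite qmonE => ->; rewrite mul0r.
Qed.

(** Multiplication by a monomial translates exponents, so this case of associativity is a change of
    variable. *)
Lemma qmul_qmonA e f g : qmul (qmul (qmon 1 e) f) g = qmul (qmon 1 e) (qmul f g).
Proof.
apply/funext => x; rewrite qmul_qmon mul1r.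
rewrite [LHS](reindex_fsbigT (fun y => y + e)).
  apply: eq_fsbigr => y _; rewrite qmul_qmon mul1r addrK; congr (_ * g _); ring.
by exists (fun y => y - e) => y; ring.
Qed.

Lemma qmul_qmonCA f e g : qmul f (qmul (qmon 1 e) g) = qmul (qmon 1 e) (qmul f g).
Proof. by rewrite [LHS]qmulC qmul_qmonA (qmulC g). Qed.

(* A family of series with finitely many coefficients below each exponent; this
   keeps the finite-support sums away from their junk value [0]. *)
Definition summable {I : choiceType} (A : set I) (F : I -> qseries) : Prop :=
  forall x, finite_set [set u : I * rat | [/\ A u.1, u.2 <= x & F u.1 u.2 != 0]].

Definition locally_finite (f : qseries) : Prop := forall x, finite_set [set y | y <= x /\ f y != 0].

Lemma summable_locally_finite {I : choiceType} (A : set I) F i : summable A F -> A i ->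
  locally_finite (F i).
Proof.
move=> sF Ai x; apply: (@sub_finite_set _ _ (snd @`
  [set u : I * rat | [/\ A u.1, u.2 <= x & F u.1 u.2 != 0]])).
  by move=> y [yx Fy]; exists (i, y).
exact: finite_image.
Qed.

Lemma summable_at {I : choiceType} (A : set I) F x :
  summable A F -> finite_set [set i | A i /\ F i x != 0].
Proof.
move=> sF; apply: (@sub_finite_set _ _ (fst @`
  [set u : I * rat | [/\ A u.1, u.2 <= x & F u.1 u.2 != 0]])).
  by move=> i [Ai Fx]; exists (i, x).
exact: finite_image.
Qed.

Lemma finite_set_lbound (D : set rat) : finite_set D -> exists B, forall y, D y -> B <= y.
Proof.
case/finite_seqP => r ->; elim: r => [|z r [B IH]]; first by exists 0.
exists (Num.min z B) => y /=; rewrite inE => /orP[/eqP ->|/IH].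
  by rewrite ge_min lexx.
by rewrite ge_min => ->; rewrite orbT.
Qed.

(** Only finitely many exponents are at most 0; a lower bound of these, capped by 0, bounds all of
    them. *)
Lemma summable_lbound {I : choiceType} (A : set I) F :
  summable A F -> exists B, forall i y, A i -> F i y != 0 -> B <= y.
Proof.
move=> sF; have [|B hB] := @finite_set_lbound (snd @`
  [set u : I * rat | [/\ A u.1, u.2 <= 0 & F u.1 u.2 != 0]]).
  by apply: finite_image; apply: sF.
exists (Num.min 0 B) => i y Ai Fy; rewrite ge_min.
have [|y0] := leP 0 y => //=; apply: hB; exists (i, y) => //; split=> //=; exact: ltW.
Qed.

Lemma locally_finite_summable f : locally_finite f -> summable [set: unit] (fun=> f).
Proof.
move=> lff x; apply: (@sub_finite_set _ _ ((fun y => (tt, y)) @` [set y | y <= x /\ f y != 0])).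
  by move=> [[] y] /= [_ yx fy]; exists y.
exact: finite_image.
Qed.

Lemma locally_finite_lbound f : locally_finite f -> exists B, forall y, f y != 0 -> B <= y.
Proof. by case/locally_finite_summable/summable_lbound => B hB; exists B => y; apply: (hB tt). Qed.

(** With lower bounds [B] for the exponents of [g] and [C] for those of the family, [y + z <= x]
    forces [y <= x - C] and [z <= x - B], which leaves a product of two finite sets. *)
Lemma summable_qmul_support {I : choiceType} (A : set I) g F x :
  locally_finite g -> summable A F ->
  finite_set [set u : (rat * I) * rat |
    [/\ A u.1.2, g u.1.1 != 0, F u.1.2 u.2 != 0 & u.1.1 + u.2 <= x]].
Proof.
move=> lg sF; have [B hB] := locally_finite_lbound _ lg; have [C hC] := summable_lbound _ _ sF.
set W1 := [set y | y <= x - C /\ g y != 0].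
set W2 := [set u : I * rat | [/\ A u.1, u.2 <= x - B & F u.1 u.2 != 0]].
apply: (@sub_finite_set _ _ ((fun v : rat * (I * rat) => ((v.1, v.2.1), v.2.2)) @` (W1 `*` W2))).
  move=> [[y i] z] /= [Ai gy Fz yz]; exists (y, (i, z)) => //; split=> /=.
    by split=> //; have := hC _ _ Ai Fz; lra.
  by split=> //=; have := hB _ gy; lra.
apply: finite_image; apply: finite_setX; [exact: lg | exact: sF].
Qed.

Lemma qmul_qsum {I : choiceType} (A : set I) g F :
  locally_finite g -> summable A F -> qmul g (qsum A F) = qsum A (fun i => qmul g (F i)).
Proof.
move=> lg sF; apply/funext => x; rewrite /qmul /qsum.
under eq_fsbigr do rewrite mulr_fsumr.
apply: exchange_fsum.
apply: (@sub_finite_set _ _ (fst @` [set u : (rat * I) * rat |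
    [/\ A u.1.2, g u.1.1 != 0, F u.1.2 u.2 != 0 & u.1.1 + u.2 <= x]])).
  move=> [y i] /= [_ Ai]; rewrite mulf_eq0 negb_or => /andP[gy Fi].
  by exists ((y, i), x - y) => //; split=> //=; lra.
by apply: finite_image; apply: summable_qmul_support.
Qed.

Lemma summable_qmul {I : choiceType} (A : set I) g F :
  locally_finite g -> summable A F -> summable A (fun i => qmul g (F i)).
Proof.
move=> lg sF x.
apply: (@sub_finite_set _ _ ((fun v : (rat * I) * rat => (v.1.2, v.1.1 + v.2)) @` [set u : (rat * I) * rat |
    [/\ A u.1.2, g u.1.1 != 0, F u.1.2 u.2 != 0 & u.1.1 + u.2 <= x]])).
  move=> [i y] /= [Ai yx] /qmul_neq0[z gz Fi].
  by exists ((z, i), y - z) => /=; [split=> //=; lra | congr pair; lra].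
by apply: finite_image; apply: summable_qmul_support.
Qed.

Lemma locally_finite_qmul f g : locally_finite f -> locally_finite g -> locally_finite (qmul f g).
Proof.
move=> hf hg; apply: (summable_locally_finite [set: unit] (fun=> qmul f g) tt) => //.
by apply: summable_qmul => //; apply: locally_finite_summable.
Qed.

Lemma locally_finite_qmon c e : locally_finite (qmon c e).
Proof.
move=> x; apply: (@sub_finite_set _ _ [set e]); last exact: finite_set1.
by move=> y [_]; rewrite /= qmonE; case: (y =P e) => // _ /eqP.
Qed.

Lemma locally_finite_qsum {I : choiceType} (A : set I) F : summable A F ->
  locally_finite (qsum A F).
Proof.
move=> sF x; apply: (@sub_finite_set _ _ (snd @`
  [set u : I * rat | [/\ A u.1, u.2 <= x & F u.1 u.2 != 0]])).
  by move=> y [yx] /fsum_neq0[i Ai Fi]; exists (i, y).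
exact: finite_image.
Qed.

Lemma qmulBr g f1 f2 : locally_finite g -> locally_finite f1 -> locally_finite f2 ->
  qmul g (f1 \- f2) = qmul g f1 \- qmul g f2.
Proof.
move=> lg l1 l2; apply/funext => x; rewrite /qmul /=.
under eq_fsbigr do rewrite mulrBr.
have fin f : locally_finite f -> finite_set [set y | [set: rat] y /\ g y * f (x - y) != 0].
  move=> lff; have [B hB] := locally_finite_lbound _ lff.
  apply: (@sub_finite_set _ _ [set y | y <= x - B /\ g y != 0]) => //.
  move=> y /= [_]; rewrite mulf_eq0 negb_or => /andP[gy /hB fy]; split=> //; lra.
by rewrite fsumB//; apply: fin.
Qed.

Lemma summable_qmon {I : choiceType} (A : set I) (e : I -> rat) :
  (forall x, finite_set [set i | e i <= x]) -> summable A (fun i => qmon 1 (e i)).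
Proof.
move=> fe x; apply: (@sub_finite_set _ _ ((fun i => (i, e i)) @` [set i | e i <= x])).
  move=> [i y] /= [Ai yx]; rewrite qmonE; case: (y =P e i) => [ye _|_ /eqP//].
  by exists i; rewrite ?ye//= -ye.
exact: finite_image.
Qed.

(** Since every [G i] has nonnegative exponents only, an exponent up to [x] is reached only from the
    finitely many [j] with [e j <= x]. *)
Lemma summable_shift {I J : choiceType} (h : J -> I) (e : J -> rat) (G : I -> qseries) :
  (forall i, locally_finite (G i)) -> (forall i x, G i x != 0 -> 0 <= x) ->
  (forall x, finite_set [set j | e j <= x]) ->
  summable [set: J] (fun j => qmul (qmon 1 (e j)) (G (h j))).
Proof.
move=> lG G0 fe x.
have fin : finite_set (\bigcup_(j in [set j | e j <= x])
    ((fun y => (j, y + e j)) @` [set y | y <= x - e j /\ G (h j) y != 0])).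
  by apply: bigcup_finite => // j _; apply: finite_image; apply: lG.
apply: sub_finite_set fin.
move=> [j y] /= [_ yx]; rewrite qmul_qmon mul1r => Gy.
exists j; first by have /= := G0 _ _ Gy; lra.
by exists (y - e j); [split=> //; lra | congr pair; lra].
Qed.

(** This unfolds a sum whose theta series are restricted to fibres into theta-like sums over all
    [j]. It serves both sides of the identity: [i] is a position [L] of alpha on one, and a string
    function index [M] on the other. *)
Lemma qsum_fibers_qmon {I J : choiceType} (A : set I) (h1 h2 : J -> I) (e1 e2 : J -> rat)
    (G : I -> qseries) :
  (forall i, locally_finite (G i)) -> (forall i x, G i x != 0 -> 0 <= x) ->
  (forall x, finite_set [set j | e1 j <= x]) -> (forall x, finite_set [set j | e2 j <= x]) ->
  (forall j, A (h1 j)) -> (forall j, A (h2 j)) ->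
  qsum A (fun i => qmul (G i)
    (qsum [set j | h1 j = i] (fun j => qmon 1 (e1 j)) \-
     qsum [set j | h2 j = i] (fun j => qmon 1 (e2 j)))) =
  qsum [set: J] (fun j => qmul (qmon 1 (e1 j)) (G (h1 j))) \-
  qsum [set: J] (fun j => qmul (qmon 1 (e2 j)) (G (h2 j))).
Proof.
move=> lG G0 fe1 fe2 A1 A2; apply/funext => x.
pose T (h : J -> I) (e : J -> rat) (j : J) := qmul (qmon 1 (e j)) (G (h j)) x.
have finT h (e : J -> rat) : (forall x, finite_set [set j | e j <= x]) ->
    finite_set [set j | T h e j != 0].
  move=> fe; have := summable_at _ _ x (summable_shift h _ _ lG G0 fe).
  by apply: sub_finite_set => j.
transitivity (\sum_(i \in A) (\sum_(j \in [set j | h1 j = i]) T h1 e1 j -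
                             \sum_(j \in [set j | h2 j = i]) T h2 e2 j)).
  apply: eq_fsbigr => i _.
  rewrite qmulBr//; [|exact/locally_finite_qsum/summable_qmon..].
  rewrite !qmul_qsum//; [|exact/summable_qmon..].
  rewrite /qsum /=; congr (_ - _).
    by apply: eq_fsbigr => j /set_mem <-; rewrite qmulC.
  by apply: eq_fsbigr => j /set_mem <-; rewrite qmulC.
rewrite fsumB.
- by rewrite (fsum_fibers A h1 _ A1 (finT _ _ fe1)) (fsum_fibers A h2 _ A2 (finT _ _ fe2)).
- apply: (@sub_finite_set _ _ (h1 @` [set j | T h1 e1 j != 0])).
    by move=> i [_] /fsum_neq0[j hj Tj]; exists j.
  by apply: finite_image; apply: finT.
- apply: (@sub_finite_set _ _ (h2 @` [set j | T h2 e2 j != 0])).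
    by move=> i [_] /fsum_neq0[j hj Tj]; exists j.
  by apply: finite_image; apply: finT.
Qed.

(** * Power series inverses *)

(** Congruence modulo ['X^k]: polynomials stand for power series known to finite order. *)
Definition eqX (k : nat) (p q : {poly int}) : Prop := forall i, (i < k)%N -> p`_i = q`_i.

Lemma eqXM k p p' q q' : eqX k p p' -> eqX k q q' -> eqX k (p * q) (p' * q').
Proof.
move=> hp hq i ik; rewrite !coefM; apply: eq_bigr => j _.
by rewrite hp ?hq//; apply: leq_ltn_trans ik; rewrite ?leq_subr// -ltnS.
Qed.

Lemma eqXW k k' p q : (k' <= k)%N -> eqX k p q -> eqX k' p q.
Proof. by move=> kk h i ik; apply: h; apply: leq_trans kk. Qed.

(** Modulo ['X^k], [v = v (p w) = (p v) w = w]. *)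
Lemma eqX_inv_unique k (p : {poly int}) v w : eqX k (p * v) 1 -> eqX k (p * w) 1 -> eqX k v w.
Proof.
move=> hv hw i ik.
transitivity ((v * (p * w))`_i); first by rewrite -[v in LHS]mulr1; apply/esym/(eqXM k).
by rewrite mulrCA mulrA -[w in RHS]mul1r; apply: (eqXM k).
Qed.

Lemma coef_exp_lt (p : {poly int}) k i : p`_0 = 0 -> (i < k)%N -> (p ^+ k)`_i = 0.
Proof.
move=> p0; elim: k i => // k IH i ik.
rewrite exprS coefM big1// => -[[|j] ji] _ /=; first by rewrite p0 mul0r.
by rewrite IH ?mulr0//; lia.
Qed.

(** For [p] with constant term 1, this truncated geometric series inverts [p] modulo ['X^(m.+1)]. *)
Definition geom (p : {poly int}) (m : nat) : {poly int} := \sum_(k < m.+1) (1 - p) ^+ k.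

Lemma mul_geom (p : {poly int}) m : p`_0 = 1 -> eqX m.+1 (p * geom p m) 1.
Proof.
move=> p0 i im; have -> : p * geom p m = 1 - (1 - p) ^+ m.+1.
  rewrite -opprB subrX1 -/(geom p m); ring.
by rewrite coefB coef_exp_lt ?subr0// coefB coef1 p0 subrr.
Qed.

Lemma ps_inv_coef (p v : {poly int}) m :
  p`_0 = 1 -> eqX m.+1 (p * v) 1 -> ps_inv (fun i => p`_i) m = v`_m.
Proof.
move=> p0 pv; rewrite /ps_inv; set t := \poly_(i < m.+1) p`_i.
have tp : eqX m.+1 t p by move=> i im; rewrite coef_poly im.
apply: (@eqX_inv_unique m.+1 t) => //; first by apply: mul_geom; rewrite coef_poly.
by move=> i im; rewrite -(pv i im); apply: (@eqXM m.+1).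
Qed.

(** The coefficient of degree [m] in the power series [A / p], for [p] with constant term 1. *)
Definition ps_quot (A p : {poly int}) (m : nat) : int := (A * geom p m)`_m.

Lemma ps_quot_ps_inv (p : {poly int}) m : p`_0 = 1 -> ps_quot 1 p m = ps_inv (fun i => p`_i) m.
Proof. by move=> p0; rewrite (@ps_inv_coef _ (geom p m)) /ps_quot ?mul1r//; apply: mul_geom. Qed.

Lemma ps_quot_cancel (A p : {poly int}) m : A`_0 = 1 -> p`_0 = 1 ->
  ps_quot A (A * p) m = ps_quot 1 p m.
Proof.
move=> A0 p0; have Ap0 : (A * p)`_0 = 1 by rewrite coef0M A0 p0 mulr1.
rewrite /ps_quot mul1r; apply: (@eqX_inv_unique m.+1 p) => //; last exact: mul_geom.
by rewrite mulrA (mulrC p); apply: mul_geom.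
Qed.

(** The shift lowers the precision required from [m] to [m - d]; the two truncated inverses agree to
    that order by uniqueness. *)
Lemma ps_quotXn d (A p : {poly int}) m : p`_0 = 1 ->
  ps_quot ('X^d * A) p m = if (d <= m)%N then ps_quot A p (m - d) else 0.
Proof.
move=> p0; rewrite /ps_quot -mulrA coefXnM; case: ltnP => // dm.
apply: (@eqXM (m - d).+1) => //.
apply: (@eqX_inv_unique _ p); last exact: mul_geom.
apply: eqXW (mul_geom _ m p0); lia.
Qed.

Lemma q_of_ps_nat a k : q_of_ps a k%:R = a k.
Proof.
rewrite /q_of_ps /qsum -(@fsbig_widen _ _ _ _ [set k]) ?fsbig_set1 /qmon ?eqxx//.
by move=> j [_ /= jk]; rewrite eqr_nat; case: eqP => // kj; rewrite kj in jk.
Qed.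

Lemma q_of_ps_neq0 a x : q_of_ps a x != 0 -> exists k, x = k%:R.
Proof.
apply: contra_neqP => nk; apply: fsbig1 => j _; rewrite /qmon.
by case: eqP => // xj; case: nk; exists j.
Qed.

Lemma q_of_ps0 x : q_of_ps (fun=> 0) x = 0.
Proof.
by apply/eqP/negPn/negP => /[dup] /q_of_ps_neq0[k ->]; rewrite q_of_ps_nat eqxx.
Qed.

Lemma q_of_ps_sum {I : Type} (r : seq I) P (a : I -> nat -> int) x :
  q_of_ps (fun m => \sum_(i <- r | P i) a i m) x = \sum_(i <- r | P i) q_of_ps (a i) x.
Proof.
case: (pselect (exists k, x = k%:R)) => [[k ->]|nk].
  by rewrite q_of_ps_nat; apply: eq_bigr => i _; rewrite q_of_ps_nat.
have z b : q_of_ps b x = 0 by apply/eqP/negPn/negP => /q_of_ps_neq0.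
by rewrite z big1.
Qed.

Lemma q_of_ps_shift d (a : nat -> int) x :
  q_of_ps (fun m => if (d <= m)%N then a (m - d)%N else 0) x = q_of_ps a (x - d%:R).
Proof.
case: (pselect (exists k, x - d%:R = k%:R)) => [[k xk]|nk].
  have -> : x = (k + d)%:R by rewrite natrD -xk subrK.
  by rewrite q_of_ps_nat leq_addl addnK natrD addrK q_of_ps_nat.
have -> : q_of_ps a (x - d%:R) = 0 by apply/eqP/negPn/negP => /q_of_ps_neq0.
apply/eqP/negPn/negP => /[dup] /q_of_ps_neq0[k xk]; rewrite xk q_of_ps_nat.
case: leqP => [dk|_]; last by rewrite eqxx.
by case: nk; exists (k - d)%N; rewrite xk natrB.
Qed.

(** * Bit strings and the peeling identity *)

Fixpoint bits (N : nat) : seq bitseq :=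
  if N is N'.+1 then map (cons true) (bits N') ++ map (cons false) (bits N') else [:: [::]].

Lemma mem_bits N S : (S \in bits N) = (size S == N).
Proof.
elim: N S => [|N IH] S; first by rewrite inE; case: S.
rewrite mem_cat; case: S => [|b S].
  by apply/negbTE/negP => /orP[] /mapP[].
rewrite eqSS -IH; apply/orP/idP => [[] /mapP[S' + [_ ->]] //|hS].
by case: b; [left|right]; apply/mapP; exists S.
Qed.

Lemma uniq_bits N : uniq (bits N).
Proof.
elim: N => //= N IH; rewrite cat_uniq !map_inj_uniq ?IH/=; try by move=> ? ? [].
by rewrite andbT; apply/hasPn => _ /mapP[S _ ->]; apply/negP => /mapP[].
Qed.

(** The recursion shifts [z] and [y], so that removing the first letter leaves a weight of the same
    kind; [bitwtE] gives the closed product. *)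
Fixpoint bitwt (R : comNzRingType) (z y : nat -> R) (S : bitseq) : R :=
  if S is b :: S' then
    (if b then z 0 else 1) * (if ~~ b && head false S' then 1 - y 0 else 1)
    * bitwt R (z \o succn) (y \o succn) S'
  else 1.

(** Induction on the length, by the first letter. A leading 1 gives [z 0] times a shorter sum. A
    leading 0 gives the full shorter sum minus [y 0] times its part that starts with 1; as
    [y 0 * z 1 = z 0], that correction is [z 0] times a sum shorter by two letters. *)
Lemma sum_bitwt (R : comNzRingType) (z y : nat -> R) N M : (forall i, z i = y i * z i.+1) ->
  \sum_(S <- bits N | count id S == M) bitwt R z y S =
  if (M <= N)%N then \prod_(N - M <= j < N) z j else 0.
Proof.
elim/ltn_ind: N z y M => -[|N] IH z y M zy.
  rewrite big_cons big_nil /=; case: M => [|M] //=; by rewrite big_geq// addr0.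
pose G z y N M := \sum_(S <- bits N | count id S == M) bitwt R z y S.
pose z' := z \o succn; pose y' := y \o succn.
have consT z0 y0 n m : \sum_(S <- map (cons true) (bits n) | count id S == m) bitwt R z0 y0 S
    = if m is m'.+1 then z0 0%N * G (z0 \o succn) (y0 \o succn) n m' else 0.
  rewrite big_map; case: m => [|m]; first by rewrite big_pred0.
  by rewrite /G mulr_sumr; apply: eq_bigr => S _ /=; rewrite mulr1.
(* The three terms correspond to the strings that start with 1, to all those that start with 0, and
   to the correction for those that start with 01. *)
have -> : \sum_(S <- bits N.+1 | count id S == M) bitwt R z y S =
  (if M is M'.+1 then z 0%N * G z' y' N M' else 0) + (G z' y' N M -
    (if N is N'.+1 then if M is M'.+1 then z 0%N * G (z' \o succn) (y' \o succn) N' M' else 0 else 0)).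
  rewrite /= big_cat consT; congr (_ + _); rewrite big_map /G.
  case: N {IH} => [|N].
    by rewrite subr0 !big_cons !big_nil /= add0n; case: ifP; rewrite ?mulr1 ?mul1r.
  rewrite /= [in RHS]big_cat !consT big_cat /=.
  rewrite [in LHS]big_map [X in _ + X = _]big_map [in RHS]big_map.
  under eq_bigl do rewrite /= add0n.
  under eq_bigr do rewrite /= mul1r mulr1.
  under [X in _ + X = _]eq_bigl do rewrite /= add0n.
  under [X in _ + X = _]eq_bigr do rewrite /= !mul1r.
  under [X in _ = _ + X - _]eq_bigr do rewrite /= !mul1r.
  case: M => [|M].
    by rewrite big_pred0//= subr0.
  rewrite -mulr_sumr -mulr_sumr -/(G _ _ _ _) /= (zy 0%N) /z' /y' /=; ring.
have IHz n m z0 y0 : (n <= N)%N -> (forall i, z0 i = y0 i * z0 i.+1) ->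
    G z0 y0 n m = if (m <= n)%N then \prod_(n - m <= j < n) z0 j else 0.
  by move=> nN; apply: IH.
have zy' : forall i, z' i = y' i * z' i.+1 by move=> i; apply: zy.
rewrite IHz//.
have shift (a b : nat) : \prod_(a <= j < b) z' j = \prod_(a.+1 <= j < b.+1) z j.
  by rewrite big_add1.
case: M => [|M].
  rewrite add0r subn0 big_geq// [in RHS]big_geq//; case: N {IH IHz} => [|N]; exact: subr0.
rewrite IHz//.
case: N IH IHz => [|N] _ IHz.
  rewrite subr0; case: M => [|M] /=; last by rewrite mulr0 addr0.
  by rewrite big_geq// mulr1 addr0 big_nat1.
rewrite IHz//; last by move=> i; apply: zy.
rewrite [(M < N.+2)%N]ltnS [(M <= N.+1)%N]leq_eqVlt [(M < N.+1)%N]ltnS.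
case: (eqVneq M N.+1) => [->|_] /=.
  rewrite ltnn !subnn mulr0 subr0 addr0 shift.
  by rewrite [RHS]big_ltn.
case: leqP => [MN|_]; last by rewrite !mulr0 subr0 addr0.
(* The first and third terms carry the same product of the last [M] values of [z], so they cancel
   and the middle term is the answer. *)
rewrite addrCA -mulrBr !subSS subSn// big_add1 subrr mulr0 addr0.
by rewrite shift.
Qed.

Lemma bitwtE (R : comNzRingType) (z y : nat -> R) S : bitwt R z y S =
  (\prod_(j < size S) if nth false S j then z j else 1) *
  (\prod_(i < size S) if ~~ nth false S i && nth false S i.+1 then 1 - y i else 1).
Proof.
elim: S z y => [|b S IH] z y /=; first by rewrite !big_ord0 mulr1.
by rewrite !big_ord_recl IH /= nth0 mulrACA.
Qed.

(** * The inverse Cartan matrix *)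

Lemma sum_delta (n k : nat) (F : nat -> rat) :
  \sum_(j < n) (k == j)%:R * F j = if (k < n)%N then F k else 0.
Proof.
case: ltnP => kn.
  rewrite (bigD1 (Ordinal kn))//= eqxx mul1r big1 ?addr0// => j jk.
  suff /negbTE -> : k != j by rewrite mul0r.
  by apply: contraNneq jk => kj; apply/eqP/val_inj.
rewrite big1// => j _; case: eqP => [kj|_]; last by rewrite mul0r.
by have := ltn_ord j; rewrite -kj ltnNge kn.
Qed.

(** The Cartan matrix is minus the second difference; the boundary values 0 make the formula uniform
    in the first and last rows. *)
Lemma cartan_mul_col (n : nat) (v : nat -> rat) : v 0%N = 0 -> v n.+1 = 0 ->
  cartan n.+1 *m (\col_(i < n) v i.+1) = \col_(i < n) (2 * v i.+1 - v i - v i.+2).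
Proof.
move=> v0 vn; apply/matrixP => i o; rewrite !mxE.
transitivity (\sum_(j < n) (2 * ((i == j :> nat)%:R * v j.+1)
   - ((i == j.+1 :> nat)%:R * v j.+1 + (i.+1 == j :> nat)%:R * v j.+1))).
  apply: eq_bigr => j _; rewrite !mxE.
  have -> : (i == j) = (i == j :> nat) by [].
  have -> : ((i.+1 == j :> nat) || (j.+1 == i :> nat))%:R =
            (i == j.+1 :> nat)%:R + (i.+1 == j :> nat)%:R :> rat.
    rewrite (eq_sym (nat_of_ord i) j.+1).
    by case: (eqVneq i.+1 j) => [<-|_]; [rewrite (negbTE (_ : i.+2 != i)) ?add0r//; lia | rewrite addr0].
  ring.
rewrite sumrB -mulr_sumr big_split /= (sum_delta n i (v \o succn)) ltn_ord /=.
rewrite (sum_delta n i.+1 (v \o succn)) /=.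
have -> : \sum_(j < n) (i == j.+1 :> nat)%:R * v j.+1 = v i.
  case: i => -[|i] /= hi; first by rewrite v0 big1// => j _; rewrite mul0r.
  by rewrite (sum_delta n i (v \o succn)) ltnW.
have -> : (if (i.+1 < n)%N then v i.+2 else 0) = v i.+2.
  by case: ltnP => // ni; have -> : i.+2 = n.+1 by (have := ltn_ord i; lia).
ring.
Qed.

Definition cartan_inv (n i j : nat) : rat := (minn i.+1 j.+1)%:R - (i.+1 * j.+1)%:R / n.+1%:R.

(** Each column is piecewise linear, vanishes at [0] and [n.+1], and has a single kink of slope
    change -1 on the diagonal, so its second difference is a delta. *)
Lemma cartan_mul_cartan_inv (n : nat) :
  cartan n.+1 *m (\matrix_(i < n, j < n) cartan_inv n i j) = 1%:M.
Proof.
apply/matrixP => i j.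
pose v (k : nat) : rat := (minn k j.+1)%:R - (k * j.+1)%:R / n.+1%:R.
have v0 : v 0%N = 0 by rewrite /v min0n mul0n mul0r subrr.
have vn : v n.+1 = 0.
  rewrite /v (minn_idPr _); last by have := ltn_ord j; lia.
  by rewrite natrM mulrAC mulfV ?mul1r ?subrr// pnatr_eq0.
have := congr1 (fun A : 'cV_n => A i ord0) (cartan_mul_col n v v0 vn).
rewrite !mxE => E; transitivity (2 * v i.+1 - v i - v i.+2).
  by rewrite -E; apply: eq_bigr => k _; rewrite !mxE.
rewrite /v !natrM -!mulrA; set c := _ / _.
have -> : (i == j) = (i == j :> nat) by [].
have [ij|ij|->] := ltngtP (i : nat) j.
- rewrite !(minn_idPl _); try lia; rewrite -!natr1 /=; ring.
- rewrite !(minn_idPr _); try lia; rewrite -!natr1 /=; ring.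
- rewrite minnn (minn_idPl (leqnSn j)) (minn_idPr (leqnSn j.+1)) -!natr1 /=; ring.
Qed.

Lemma cartan_unit (n : nat) : cartan n.+1 \in unitmx.
Proof. by case: (mulmx1_unit (cartan_mul_cartan_inv n)). Qed.

Lemma invmx_cartan (n : nat) : invmx (cartan n.+1) = \matrix_(i < n, j < n) cartan_inv n i j.
Proof. by rewrite -[RHS](mulKmx (cartan_unit n)) cartan_mul_cartan_inv mulmx1. Qed.

Lemma CformE (n : nat) (u v : 'cV[rat]_n) :
  Cform (N := n.+1) u v = \sum_(i < n) \sum_(j < n) u i ord0 * cartan_inv n i j * v j ord0.
Proof.
rewrite /Cform invmx_cartan mxE exchange_big /=; apply: eq_bigr => j _.
by rewrite mxE mulr_suml; apply: eq_bigr => i _; rewrite !mxE.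
Qed.

Lemma CformC (n : nat) (u v : 'cV[rat]_n) : Cform (N := n.+1) u v = Cform (N := n.+1) v u.
Proof.
rewrite !CformE exchange_big /=; apply: eq_bigr => i _; apply: eq_bigr => j _.
by rewrite /cartan_inv minnC mulnC; ring.
Qed.

Lemma CformDr (n : nat) (u v w : 'cV[rat]_n) :
  Cform (N := n.+1) u (v + w) = Cform (N := n.+1) u v + Cform (N := n.+1) u w.
Proof. by rewrite /Cform mulmxDr mxE. Qed.

Lemma CformNr (n : nat) (u v : 'cV[rat]_n) :
  Cform (N := n.+1) u (- v) = - Cform (N := n.+1) u v.
Proof. by rewrite /Cform mulmxN mxE. Qed.

(** A vector that is minus the second difference of [v] has [v] as its image under the inverse
    Cartan matrix, by [cartan_mul_col]. *)
Lemma Cform_potential (n : nat) (u : 'cV[rat]_n) (v : nat -> rat) :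
  v 0%N = 0 -> v n.+1 = 0 ->
  Cform (N := n.+1) u (\col_(i < n) (2 * v i.+1 - v i - v i.+2)) =
  \sum_(i < n) u i ord0 * v i.+1.
Proof.
move=> v0 vn; rewrite /Cform -cartan_mul_col// -mulmxA mulKmx ?cartan_unit// mxE.
by apply: eq_bigr => i _; rewrite !mxE.
Qed.

(** The form [min * (N - max) / N] makes both positivity and invariance under reversal visible. *)
Lemma cartan_invE (n i j : nat) : (i < n)%N -> (j < n)%N ->
  cartan_inv n i j = (minn i.+1 j.+1 * (n.+1 - maxn i.+1 j.+1))%:R / n.+1%:R.
Proof.
move=> hi hj; rewrite /cartan_inv.
have -> : (i.+1 * j.+1 = minn i.+1 j.+1 * maxn i.+1 j.+1)%N.
  by rewrite minnC maxnC; case: leqP => // _; rewrite mulnC.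
rewrite [in RHS]natrM natrB; last by lia.
by rewrite natrM mulrBr mulrBl mulfK// pnatr_eq0.
Qed.

Lemma cartan_inv_ge (n i j : nat) : (i < n)%N -> (j < n)%N -> n.+1%:R^-1 <= cartan_inv n i j.
Proof.
move=> hi hj; rewrite cartan_invE// -[leLHS]mul1r ler_pM2r ?invr_gt0 ?ltr0Sn//.
by rewrite ler1n muln_gt0; lia.
Qed.

Lemma cartan_inv_ge0 (n i j : nat) : (i < n)%N -> (j < n)%N -> 0 <= cartan_inv n i j.
Proof. by move=> hi hj; apply: le_trans (cartan_inv_ge _ _ _ hi hj); rewrite invr_ge0. Qed.

Lemma cartan_inv_le_diag (n i j : nat) : (i < n)%N -> (j < n)%N ->
  cartan_inv n i j <= cartan_inv n i i.
Proof.
move=> hi hj; rewrite !cartan_invE// ler_pM2r ?invr_gt0 ?ltr0Sn// ler_nat.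
by apply: leq_mul; lia.
Qed.

(** Reversal, the symmetry of the Dynkin diagram, exchanges [min] with [N - max]. *)
Lemma cartan_inv_rev (n : nat) (i j : 'I_n) :
  cartan_inv n (rev_ord i) (rev_ord j) = cartan_inv n i j.
Proof.
rewrite !cartan_invE// mulnC /=; have := ltn_ord i; have := ltn_ord j => hj hi.
congr (_%:R / _); congr (_ * _)%N; lia.
Qed.

Definition rev_vec {T : Type} (n : nat) (u : 'cV[T]_n) : 'cV[T]_n := \col_i u (rev_ord i) ord0.

Lemma Cform_rev (n : nat) (u v : 'cV[rat]_n) :
  Cform (N := n.+1) (rev_vec n u) (rev_vec n v) = Cform (N := n.+1) u v.
Proof.
rewrite !CformE (reindex_inj rev_ord_inj) /=; apply: eq_bigr => i _.
rewrite (reindex_inj rev_ord_inj) /=; apply: eq_bigr => j _.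
by rewrite cartan_inv_rev !mxE !rev_ordK.
Qed.

(** All entries of the inverse Cartan matrix are at least [1 / N], so one diagonal term already
    gives the bound. *)
Lemma Cform_ge_entry (n : nat) (u v : 'cV[rat]_n) (i : 'I_n) :
  (forall i, 0 <= u i ord0) -> (forall i, 0 <= v i ord0) ->
  u i ord0 * v i ord0 <= n.+1%:R * Cform (N := n.+1) u v.
Proof.
move=> u0 v0; rewrite -ler_pdivrMl ?ltr0Sn// CformE.
have pos (j k : 'I_n) : 0 <= u j ord0 * cartan_inv n j k * v k ord0 by rewrite !mulr_ge0 ?cartan_inv_ge0.
rewrite (bigD1 i)//= (bigD1 i)//= -addrA; apply: ler_wpDr.
  by apply: addr_ge0; apply: sumr_ge0 => j _ //; apply: sumr_ge0.
by rewrite [u _ _ * cartan_inv _ _ _]mulrC -mulrA ler_wpM2r ?mulr_ge0 ?cartan_inv_ge.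
Qed.

(* The diagonal entry [cartan_inv n j j] dominates the row [cartan_inv n j]. *)
Lemma Cform_fermi_ge_sum (n l : nat) (m : 'cV[nat]_n) :
  \sum_(j < n) cartan_inv n j j * ((m j ord0)%:R * ((m j ord0)%:R - 1)) <=
  Cform (N := n.+1) (ratv (N := n.+1) m) (ratv (N := n.+1) m - unitv n.+1 l).
Proof.
rewrite CformDr CformNr !CformE.
have unit_sum j : \sum_(k < n) (ratv (N := n.+1) m) j ord0 * cartan_inv n j k * (unitv n.+1 l) k ord0
    <= (m j ord0)%:R * cartan_inv n j j.
  have [hl|hl] := boolP (has (fun k : 'I_n => k.+1 == l) (index_enum _)).
    have [k _ /eqP kl] := hasP hl.
    rewrite (bigD1 k)//= big1 => [|k' /negP k'k].
      rewrite !mxE kl eqxx mulr1 addr0 ler_wpM2l ?ler0n//; exact: cartan_inv_le_diag.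
    rewrite !mxE; case: eqP => [|_]; last by rewrite mulr0.
    by rewrite -kl => -[] /val_inj k'E; case: k'k; rewrite k'E.
  rewrite big1 ?mulr_ge0 ?cartan_inv_ge0// => k _; rewrite !mxE; case: eqP => [kl|_]; last first.
    by rewrite mulr0.
  by case/hasP: hl; exists k; rewrite ?mem_index_enum ?kl.
rewrite -sumrB; apply: ler_sum => j _.
have diag : (m j ord0)%:R * cartan_inv n j j * (m j ord0)%:R <=
    \sum_(k < n) (ratv (N := n.+1) m) j ord0 * cartan_inv n j k * (ratv (N := n.+1) m) k ord0.
  rewrite (bigD1 j)//= !mxE lerDl; apply: sumr_ge0 => k _.
  by rewrite !mxE !mulr_ge0 ?ler0n ?cartan_inv_ge0.
have := unit_sum j; move: diag; set A := \sum_(k < n) _; set B := \sum_(k < n) _; lra.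
Qed.

Lemma mul_pred_ge0 (a : nat) : 0 <= a%:R * (a%:R - 1) :> rat.
Proof.
case: a => [|k]; first by rewrite mul0r.
by rewrite -natr1 addrK mulr_ge0 ?addr_ge0 ?ler0n.
Qed.

Lemma Cform_fermi_ge0 (n l : nat) (m : 'cV[nat]_n) :
  0 <= Cform (N := n.+1) (ratv (N := n.+1) m) (ratv (N := n.+1) m - unitv n.+1 l).
Proof.
apply: le_trans (Cform_fermi_ge_sum n l m); apply: sumr_ge0 => j _.
by rewrite mulr_ge0 ?mul_pred_ge0 ?cartan_inv_ge0.
Qed.

Lemma Cform_fermi_ge (n l : nat) (m : 'cV[nat]_n) (i : 'I_n) :
  (m i ord0)%:R - 1 <=
  n.+1%:R * Cform (N := n.+1) (ratv (N := n.+1) m) (ratv (N := n.+1) m - unitv n.+1 l).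
Proof.
have nn0 : 0 < n.+1%:R :> rat by rewrite ltr0Sn.
(* For a natural number [a], [a - 1 <= a (a - 1)], including at [a = 0]. *)
apply: (@le_trans _ _ ((m i ord0)%:R * ((m i ord0)%:R - 1))).
  case: (m i ord0) => [|k]; first by rewrite mul0r; lra.
  rewrite -natr1 addrK ler_peMl ?ler0n//; have := ler0n rat k; lra.
rewrite -(ler_pdivrMl _ _ nn0); apply: le_trans (Cform_fermi_ge_sum n l m).
rewrite (bigD1 i)//=; apply: ler_wpDr; last first.
  by apply: ler_wpM2r; rewrite ?mul_pred_ge0// cartan_inv_ge.
by apply: sumr_ge0 => j _; rewrite mulr_ge0 ?mul_pred_ge0 ?cartan_inv_ge0.
Qed.

(** * Expansion over bit strings *)

Definition descent (S : bitseq) (i : nat) : bool := nth false S i && ~~ nth false S i.+1.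
Definition ascent (S : bitseq) (i : nat) : bool := ~~ nth false S i && nth false S i.+1.

Definition descentv (n : nat) (S : bitseq) : 'cV[nat]_n := \col_i (descent S i : nat).
Definition ascentv (n : nat) (S : bitseq) : 'cV[nat]_n := \col_i (ascent S i : nat).

Definition psum (S : bitseq) (i : nat) : nat := \sum_(j < i) nth false S j.

Lemma psum_count S : psum S (size S) = count id S.
Proof.
by rewrite -sum1_count big_mkcond (big_nth false) big_mkord; apply: eq_bigr => i _; case: nth.
Qed.

(** Descents minus ascents are minus the second difference of the partial sums of [S]. Subtracting
    the linear function with the same end value makes these vanish at both ends, so
    [Cform_potential] applies. *)
Lemma Cform_bits (n : nat) (S : bitseq) (u : 'cV[rat]_n) : size S = n.+1 ->
  Cform (N := n.+1) u (ratv (N := n.+1) (descentv n S) - ratv (N := n.+1) (ascentv n S)) =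
  \sum_(i < n) u i ord0 * ((psum S i.+1)%:R - i.+1%:R * ((count id S)%:R / n.+1%:R)).
Proof.
move=> sS; pose v i : rat := (psum S i)%:R - i%:R * ((count id S)%:R / n.+1%:R).
have v0 : v 0%N = 0 by rewrite /v /psum big_ord0 mul0r subrr.
have vn : v n.+1 = 0.
  by rewrite /v -sS psum_count mulrC divfK ?subrr// pnatr_eq0 sS.
rewrite -(Cform_potential n u v v0 vn); congr Cform; apply/matrixP => i o.
rewrite !mxE /v /psum !big_ord_recr /= !natrD /descent /ascent -!natr1.
by case: nth; case: nth => /=; ring.
Qed.

Definition tailsum (n : nat) (m : 'cV[nat]_n) (j : nat) : nat := \sum_(k < n | (j <= k)%N) m k ord0.

(** The exponent of the product of the [z_j] over the letters 1 of [S]. *)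
Definition bitsum (n : nat) (m : 'cV[nat]_n) (S : bitseq) : nat :=
  \sum_(j < n.+1) nth false S j * tailsum n m j.

(** Each [m k] is counted once per letter 1 among the first [k.+1]. This is the sum that
    [Cform_bits] produces. *)
Lemma bitsumE (n : nat) (m : 'cV[nat]_n) (S : bitseq) :
  bitsum n m S = \sum_(k < n) m k ord0 * psum S k.+1.
Proof.
rewrite /bitsum.
under eq_bigr do rewrite /tailsum big_mkcond big_distrr /=.
rewrite exchange_big /=; apply: eq_bigr => k _.
rewrite /psum (big_ord_widen n.+1 (fun j => nth false S j : nat)); last by rewrite ltnS ltnW.
rewrite big_distrr [RHS]big_mkcond /=; apply: eq_bigr => j _.
by rewrite ltnS; case: ifP; rewrite ?muln0// mulnC.
Qed.

(** The peeling identity at [z_i = X^(tailsum)] and [y_i = X^(m_i)]; its product over the last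
    positions belongs to the sorted string of [l] zeros followed by ones. *)
Lemma bits_sum_expansion (n l : nat) (m : 'cV[nat]_n) : (l <= n)%N ->
  'X^(bitsum n m (nseq l false ++ nseq (n.+1 - l) true)) =
  \sum_(S <- bits n.+1 | count id S == (n.+1 - l)%N)
    'X^(bitsum n m S) * \prod_(i < n) (if ascent S i then 1 - 'X^(m i ord0) else 1) :> {poly int}.
Proof.
move=> ln.
(* [a] extends [m] by zero, so that [z i = y i * z i.+1] holds at every natural index. *)
pose a (i : nat) := (\sum_(k < n | i == k :> nat) m k ord0)%N.
have aE (i : 'I_n) : a i = m i ord0.
  by rewrite /a (big_pred1 i)// => k; rewrite eq_sym.
pose z (i : nat) : {poly int} := 'X^(tailsum n m i); pose y (i : nat) : {poly int} := 'X^(a i).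
have zy i : z i = y i * z i.+1.
  rewrite /z /y -exprD; congr (_ ^+ _); rewrite /a /tailsum.
  rewrite big_mkcond [X in (X + _)%N]big_mkcond [X in (_ + X)%N]big_mkcond -big_split /=.
  by apply: eq_bigr => k _; case: ltngtP => //=; rewrite addn0.
transitivity (\prod_(l <= j < n.+1) z j).
  rewrite prodrXr big_geq_mkord big_mkcond; congr (_ ^+ _); apply: eq_bigr => j _.
  rewrite nth_cat size_nseq !nth_nseq.
  case: ltnP => lj /=; first by [].
  by rewrite (_ : (j - l < n.+1 - l)%N) ?mul1n//; have := ltn_ord j; lia.
rewrite -[l in LHS](subKn (leqW ln)).
have := sum_bitwt _ z y n.+1 (n.+1 - l)%N zy; rewrite leq_subr => <-.
rewrite big_seq_cond [RHS]big_seq_cond; apply: eq_bigr => S /andP[].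
rewrite mem_bits => /eqP sS _; rewrite bitwtE sS; congr (_ * _).
  rewrite /bitsum -prodrXr; apply: eq_bigr => j _.
  by case: nth; rewrite ?mul1n ?mul0n.
(* The last letter is followed by the default [false], hence is no ascent, and its factor is 1. *)
rewrite big_ord_recr /= (nth_default false (_ : size S <= n.+1)%N) ?sS// andbF mulr1.
by apply: eq_bigr => i _; rewrite /y aE.
Qed.

Lemma coef0_qpoch k : (qpoch k)`_0 = 1.
Proof.
rewrite -horner_coef0 /qpoch horner_prod big_nat big1// => i /andP[i0 _].
by rewrite hornerD hornerN hornerXn hornerC expr0n gtn_eqF// subr0.
Qed.

Lemma qpochS k : qpoch k.+1 = (1 - 'X^(k.+1)) * qpoch k.
Proof. by rewrite /qpoch big_nat_recr//= mulrC. Qed.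

Definition qpochv (n : nat) (m : 'cV[nat]_n) : {poly int} := \prod_(i < n) qpoch (m i ord0).

Lemma coef0_prod_eq1 {I : Type} (r : seq I) (P : pred I) (F : I -> {poly int}) :
  (forall i, P i -> (F i)`_0 = 1) -> (\prod_(i <- r | P i) F i)`_0 = 1.
Proof.
move=> F1; rewrite -horner_coef0 horner_prod big1// => i Pi.
by rewrite horner_coef0 F1.
Qed.

Lemma coef0_qpochv (n : nat) (m : 'cV[nat]_n) : (qpochv n m)`_0 = 1.
Proof. by apply: coef0_prod_eq1 => i _; apply: coef0_qpoch. Qed.

Definition sub_vec (n : nat) (m e : 'cV[nat]_n) : 'cV[nat]_n := \col_i (m i ord0 - e i ord0)%N.

(** The condition under which the truncated subtraction of the ascents from [m] is exact. *)
Definition covers (n : nat) (S : bitseq) (m : 'cV[nat]_n) : Prop :=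
  forall i, (ascentv n S i ord0 <= m i ord0)%N.

(** At an ascent, [1 - X^(m_i)] cancels the top factor of [(q)_(m_i)] and lowers [m_i] by one; if
    [m_i = 0] there, this factor is 0 and the term disappears. *)
Lemma ps_quot_ascent (n : nat) (S : bitseq) (m : 'cV[nat]_n) k :
  ps_quot (\prod_(i < n) (if ascent S i then 1 - 'X^(m i ord0) else 1)) (qpochv n m) k =
  if `[< covers n S m >] then ps_inv (fun i => (qpochv n (sub_vec n m (ascentv n S)))`_i) k else 0.
Proof.
case: asboolP => [cov|ncov].
  rewrite -ps_quot_ps_inv ?coef0_qpochv//.
  have -> : qpochv n m = (\prod_(i < n) (if ascent S i then 1 - 'X^(m i ord0) else 1))
                         * qpochv n (sub_vec n m (ascentv n S)).
    rewrite /qpochv -big_split; apply: eq_bigr => i _; have := cov i; rewrite !mxE.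
    case: ascent => /=; last by rewrite subn0 mul1r.
    by case: (m i ord0) => // j _; rewrite subn1 /= qpochS.
  apply: ps_quot_cancel; last exact: coef0_qpochv.
  apply: coef0_prod_eq1 => i _; have := cov i; rewrite !mxE.
  case: ascent => /= [m1|_]; last by rewrite coef1.
  by rewrite coefB coef1 coefXn; case: (m i ord0) m1 => //= j _; rewrite subr0.
suff [i Di mi] : exists2 i : 'I_n, ascent S i & m i ord0 = 0%N.
  by rewrite (bigD1 i)//= Di mi expr0 subrr mul0r /ps_quot mul0r coef0.
apply: contrapT => h; apply: ncov => i; rewrite mxE.
have [Di|//] := boolP (ascent S i); rewrite /= lt0n; apply/eqP => mi.
by apply: h; exists i.
Qed.

Definition bitset (N M : nat) : set bitseq := [set S | size S = N /\ count id S = M].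

Lemma bitset_mem N M : bitset N M = [set` [seq S <- bits N | count id S == M]].
Proof.
apply/seteqP; split=> S; rewrite /= mem_filter mem_bits.
  by case=> -> ->; rewrite !eqxx.
by case/andP=> /eqP ? /eqP ?.
Qed.

Lemma finite_bitset N M : finite_set (bitset N M).
Proof. by rewrite bitset_mem; apply: finite_seq. Qed.

(** The summand left after the shift by the ascents; its exponent treats ascents and descents alike,
    which reversal exploits. *)
Definition bit_term (n : nat) (S : bitseq) (m : 'cV[nat]_n) : qseries :=
  qmul (qmon 1 (Cform (N := n.+1) (ratv (N := n.+1) (m + ascentv n S))
                                 (ratv (N := n.+1) (m + descentv n S))))
       (q_of_ps (ps_inv (fun k => (qpochv n m)`_k))).

Lemma ratvD (n : nat) (u v : 'cV[nat]_n) :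
  ratv (N := n.+1) (u + v) = ratv (N := n.+1) u + ratv (N := n.+1) v.
Proof. by apply/matrixP => i j; rewrite !mxE natrD. Qed.

(** The sorted string has no descent at these positions and at most one ascent, between letters [l]
    and [l + 1]. Thus the linear part of the fermionic exponent has the form treated by
    [Cform_bits]. *)
Lemma unitv_bits (n l : nat) : (l <= n)%N ->
  - unitv n.+1 l = ratv (N := n.+1) (descentv n (nseq l false ++ nseq (n.+1 - l) true))
    - ratv (N := n.+1) (ascentv n (nseq l false ++ nseq (n.+1 - l) true)).
Proof.
move=> ln; have nthS i : nth false (nseq l false ++ nseq (n.+1 - l) true) i = (l <= i < n.+1)%N.
  rewrite nth_cat size_nseq !nth_nseq; case: ltnP => //= li.
  by case: ltnP => h; [symmetry|symmetry; apply/negbTE]; lia.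
apply/matrixP => i j; rewrite !mxE /descent /ascent !nthS.
have hi := ltn_ord i.
have -> : (l <= i < n.+1)%N && ~~ (l <= i.+1 < n.+1)%N = false by move: hi => /=; lia.
have -> : ~~ (l <= i < n.+1)%N && (l <= i.+1 < n.+1)%N = (i.+1 == l) by move: hi => /=; lia.
by rewrite sub0r.
Qed.

Lemma subvK (n : nat) (S : bitseq) (m : 'cV[nat]_n) : covers n S m ->
  sub_vec n m (ascentv n S) + ascentv n S = m.
Proof.
move=> cov; apply/matrixP => i j; rewrite (ord1 j) [LHS]mxE [X in X + _]mxE.
exact: (subnK (cov i)).
Qed.

(** The exponent of the term at [m] is that of the sorted string. Expanding its [bitsum] over all
    [S] replaces [- e_l] by descents minus ascents of [S], and writing [m] as a shifted vector plus
    the ascents gives the exponent of [bit_term]. *)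
Lemma fermi_term_expand (n l : nat) (m : 'cV[nat]_n) x : (l <= n)%N ->
  fermi_term (N := n.+1) l m x =
  \sum_(S \in bitset n.+1 (n.+1 - l))
    if `[< covers n S m >] then bit_term n S (sub_vec n m (ascentv n S)) x else 0.
Proof.
move=> ln; rewrite bitset_mem -fsbig_seq ?filter_uniq ?uniq_bits// big_filter.
rewrite /fermi_term qmul_qmon mul1r unitv_bits//.
set S0 := nseq l false ++ _.
(* The linear correction of [Cform_bits] depends on [S] only through its number of ones, so it is
   common to the sorted string and to all the others. *)
pose kap := \sum_(i < n) (m i ord0)%:R * (i.+1%:R * ((n.+1 - l)%:R / n.+1%:R)) : rat.
have cf S : size S = n.+1 -> count id S = (n.+1 - l)%N ->
    Cform (N := n.+1) (ratv (N := n.+1) m) (ratv (N := n.+1) m +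
      (ratv (N := n.+1) (descentv n S) - ratv (N := n.+1) (ascentv n S))) =
    Cform (N := n.+1) (ratv (N := n.+1) m) (ratv (N := n.+1) m) + (bitsum n m S)%:R - kap.
  move=> sS cS; rewrite CformDr -addrA; congr (_ + _).
  rewrite Cform_bits// cS /kap bitsumE natr_sum -sumrB; apply: eq_bigr => i _.
  by rewrite mxE natrM mulrBr.
rewrite cf; first last.
- by rewrite /S0 count_cat !count_nseq /= mul0n mul1n.
- by rewrite size_cat !size_nseq subnKC// ltnW.
set Q := Cform _ _.
rewrite -/(qpochv n m).
transitivity (q_of_ps (ps_quot 'X^(bitsum n m S0) (qpochv n m)) (x - (Q - kap))).
  rewrite -['X^_]mulr1.
  have -> : ps_quot ('X^(bitsum n m S0) * 1) (qpochv n m) = fun k =>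
      if (bitsum n m S0 <= k)%N then ps_inv (fun k => (qpochv n m)`_k) (k - bitsum n m S0)%N else 0.
    by apply/funext => k; rewrite ps_quotXn ?coef0_qpochv// ps_quot_ps_inv ?coef0_qpochv.
  by rewrite q_of_ps_shift; congr q_of_ps; ring.
rewrite bits_sum_expansion//.
have -> : forall (F : bitseq -> {poly int}) (r : seq bitseq) P,
    ps_quot (\sum_(S <- r | P S) F S) (qpochv n m) =
    fun k => \sum_(S <- r | P S) ps_quot (F S) (qpochv n m) k.
  by move=> F r P; apply/funext => k; rewrite /ps_quot mulr_suml coef_sum.
rewrite q_of_ps_sum big_seq_cond [RHS]big_seq_cond; apply: eq_bigr => S /andP[].
rewrite mem_bits => /eqP sS /eqP cS.
have -> : ps_quot ('X^(bitsum n m S) *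
    \prod_(i < n) (if ascent S i then 1 - 'X^(m i ord0) else 1)) (qpochv n m)
   = fun k => if (bitsum n m S <= k)%N then
      (if `[< covers n S m >] then
         ps_inv (fun i => (qpochv n (sub_vec n m (ascentv n S)))`_i) (k - bitsum n m S)%N
       else 0) else 0.
  by apply/funext => k; rewrite ps_quotXn ?coef0_qpochv// ps_quot_ascent.
rewrite (q_of_ps_shift _ (fun k => if `[< covers n S m >] then
  ps_inv (fun i => (qpochv n (sub_vec n m (ascentv n S)))`_i) k else 0)).
case: asboolP => cov; last exact: q_of_ps0.
rewrite /bit_term qmul_qmon mul1r subvK//; congr q_of_ps.
have -> : ratv (N := n.+1) (sub_vec n m (ascentv n S) + descentv n S) =
    ratv (N := n.+1) m + (ratv (N := n.+1) (descentv n S) - ratv (N := n.+1) (ascentv n S)).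
  by rewrite -[in RHS](subvK _ _ _ cov) !ratvD -addrA (addrCA (ratv (N := n.+1) (ascentv n S))) subrr addr0.
by rewrite cf// -/Q; ring.
Qed.

(** * Symmetry of the fermionic sums *)

Lemma locally_finite_q_of_ps a : locally_finite (q_of_ps a).
Proof.
move=> x; apply: (@sub_finite_set _ _ ((fun k : nat => k%:R) @` `I_(Num.bound `|x|))).
  move=> y [yx /q_of_ps_neq0[k yk]]; exists k; rewrite ?yk//= -(ltr_nat rat) -yk.
  apply: le_lt_trans yx _; apply: le_lt_trans (ler_norm x) _.
  exact: (archi_boundP (normr_ge0 x)).
apply: finite_image; exact: finite_II.
Qed.

Lemma finite_bounded_vectors (n B : nat) :
  finite_set [set m : 'cV[nat]_n | forall i, (m i ord0 <= B)%N].
Proof.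
apply: (@sub_finite_set _ _ ((fun f : {ffun 'I_n -> 'I_B.+1} => \col_i (f i : nat)) @` [set: _])).
  move=> m mB; exists [ffun i => inord (m i ord0)] => //.
  by apply/matrixP => i j; rewrite mxE ffunE inordK ?(ord1 j) ?ltnS.
apply: finite_image; exact: finite_finset.
Qed.

Lemma fermi_term_ge (n l : nat) (m : 'cV[nat]_n) x : fermi_term (N := n.+1) l m x != 0 ->
  Cform (N := n.+1) (ratv (N := n.+1) m) (ratv (N := n.+1) m - unitv n.+1 l) <= x.
Proof.
rewrite /fermi_term qmul_qmon mul1r => /q_of_ps_neq0[k]; have := ler0n rat k; lra.
Qed.

Lemma finite_entry_bound (n : nat) (x : rat) (P : set 'cV[nat]_n) :
  (forall m i, P m -> (m i ord0)%:R <= x) -> finite_set P.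
Proof.
move=> Px; apply: sub_finite_set (finite_bounded_vectors n (Num.bound `|x|)).
move=> m /Px mx i; rewrite -(ler_nat rat); apply: le_trans (mx i) _.
apply: le_trans (ler_norm x) _; exact: (ltW (archi_boundP (normr_ge0 x))).
Qed.

Lemma summable_fermi_term (n l : nat) (A : set 'cV[nat]_n) :
  summable A (fermi_term (N := n.+1) l).
Proof.
move=> x; pose E (m : 'cV[nat]_n) :=
  Cform (N := n.+1) (ratv (N := n.+1) m) (ratv (N := n.+1) m - unitv n.+1 l).
have fin : finite_set (\bigcup_(m in [set m | E m <= x])
    ((fun y => (m, y)) @` [set y | y <= x /\ fermi_term (N := n.+1) l m y != 0])).
  apply: bigcup_finite.
    apply: (@finite_entry_bound _ (n.+1%:R * x + 1)) => m i /= mx.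
    have := Cform_fermi_ge n l m i; rewrite -/(E m).
    have : n.+1%:R * E m <= n.+1%:R * x by rewrite ler_wpM2l.
    lra.
  move=> m _; apply: finite_image; apply: locally_finite_qmul.
    exact: locally_finite_qmon.
  exact: locally_finite_q_of_ps.
apply: sub_finite_set fin => -[m y] /= [_ yx mn].
exists m; first exact: le_trans (fermi_term_ge _ _ _ _ mn) yx.
by exists y.
Qed.

(** The common shape of the fermionic sums on both sides. Modulo 1, [Cinv1 m] is minus the sum of
    the [i m_i / N]. *)
Definition fermi_class (n l : nat) (c : rat) : qseries :=
  qsum [set m : 'cV[nat]_n | Cinv1 (N := n.+1) m - c \is a Num.int] (fermi_term (N := n.+1) l).

Lemma locally_finite_fermi_class n l c : locally_finite (fermi_class n l c).
Proof. by apply: locally_finite_qsum; apply: summable_fermi_term. Qed.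

Lemma fermi_class_ge0 n l c x : fermi_class n l c x != 0 -> 0 <= x.
Proof.
case/fsum_neq0 => m _ /fermi_term_ge; apply: le_trans; exact: Cform_fermi_ge0.
Qed.

Lemma Cinv1E (n : nat) (m : 'cV[nat]_n) :
  Cinv1 (N := n.+1) m = \sum_(j < n) cartan_inv n 0 j * (m j ord0)%:R.
Proof.
case: n m => [|n] m; first by rewrite /Cinv1 CformE !big_ord0.
rewrite /Cinv1 CformE (bigD1 ord0)//= [X in _ + X]big1 ?addr0.
  by apply: eq_bigr => j _; rewrite !mxE mul1r.
move=> i i0; apply: big1 => j _; rewrite mxE.
have -> : (i.+1 == 1)%N = false by apply/negbTE; rewrite eqSS; apply: contraNneq i0 => h; apply/eqP/val_inj.
by rewrite !mul0r.
Qed.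

Lemma Cinv1D (n : nat) (u v : 'cV[nat]_n) :
  Cinv1 (N := n.+1) (u + v) = Cinv1 (N := n.+1) u + Cinv1 (N := n.+1) v.
Proof. by rewrite /Cinv1 ratvD CformDr. Qed.

(** The entries [j] and [N - j] of the first row of the inverse Cartan matrix add up to 1, so the
    sum is the total of the entries of [m]. *)
Lemma Cinv1_rev (n : nat) (m : 'cV[nat]_n) :
  Cinv1 (N := n.+1) (rev_vec n m) + Cinv1 (N := n.+1) m \is a Num.int.
Proof.
rewrite !Cinv1E (reindex_inj rev_ord_inj) -big_split /=.
rewrite (_ : \sum_(i < n) _ = \sum_(i < n) (m i ord0)%:R).
  by rewrite -natr_sum; apply: natr_int.
apply: eq_bigr => j _; rewrite mxE rev_ordK -mulrDl -[RHS]mul1r; congr (_ * _).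
have hj := ltn_ord j; rewrite !cartan_invE//=; try lia.
rewrite -mulrDl -natrD (_ : (_ + _)%N = n.+1) ?divff ?pnatr_eq0//; lia.
Qed.

(** By [Cform_bits] the first coordinate is the first letter of [S] minus [(N - l) / N]. *)
Lemma Cinv1_bits (n l : nat) (S : bitseq) : (l <= n)%N -> bitset n.+1 (n.+1 - l) S ->
  Cinv1 (N := n.+1) (descentv n S) - Cinv1 (N := n.+1) (ascentv n S) - l%:R / n.+1%:R \is a Num.int.
Proof.
move=> ln [sS cS]; rewrite /Cinv1 -CformNr -CformDr Cform_bits// cS.
case: n ln sS cS => [|n] ln sS cS.
  (* For [N = 1] there is no first coordinate, and [l] is 0. *)
  by rewrite big_ord0 (_ : l = 0%N) ?mul0r ?subr0 ?rpred0//; apply/eqP; rewrite -leqn0.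
rewrite (bigD1 ord0)//= big1 => [|i i0].
  rewrite !mxE eqxx mul1r mul1r addr0 (natrB _ (leqW ln)) mulrBl divff ?pnatr_eq0//.
  rewrite (_ : _ - _ = (psum S 1)%:R - 1); last by ring.
  by rewrite rpredB ?natr_int ?rpred1.
rewrite mxE (_ : (i.+1 == 1)%N = false) ?mul0r//.
by apply/negbTE; rewrite eqSS; apply: contraNneq i0 => h; apply/eqP/val_inj.
Qed.

Lemma bit_term_entry (n : nat) (S : bitseq) (m : 'cV[nat]_n) x (i : 'I_n) :
  bit_term n S m x != 0 -> (m i ord0)%:R <= n.+1%:R * x.
Proof.
rewrite /bit_term qmul_qmon mul1r => /q_of_ps_neq0[k]; set E := Cform _ _ => xk.
have : n.+1%:R * E <= n.+1%:R * x by rewrite ler_wpM2l//; have := ler0n rat k; lra.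
apply: le_trans; apply: le_trans (Cform_ge_entry n _ _ i _ _).
- by rewrite !mxE -natrM ler_nat; case: (m i ord0) => // a; nia.
- by move=> j; rewrite mxE ler0n.
- by move=> j; rewrite mxE ler0n.
Qed.

Lemma finite_bit_term (n : nat) (S : bitseq) x :
  finite_set [set m : 'cV[nat]_n | bit_term n S m x != 0].
Proof. by apply: (@finite_entry_bound _ (n.+1%:R * x)) => m i; apply: bit_term_entry. Qed.

Lemma subv_add (n : nat) (m e : 'cV[nat]_n) : sub_vec n (m + e) e = m.
Proof. by apply/matrixP => i j; rewrite !mxE (ord1 j) addnK. Qed.

(** After exchanging the sums over [m] and [S], adding the ascents of [S] is a bijection onto the
    vectors that cover them. *)
Lemma fermi_class_bits (n l : nat) c x : (l <= n)%N ->
  fermi_class n l c x = \sum_(S \in bitset n.+1 (n.+1 - l))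
    \sum_(m \in [set m : 'cV[nat]_n | Cinv1 (N := n.+1) (m + ascentv n S) - c \is a Num.int])
      bit_term n S m x.
Proof.
move=> ln; rewrite /fermi_class /qsum.
under eq_fsbigr do rewrite fermi_term_expand//.
rewrite exchange_fsum; last first.
  have fin : finite_set (\bigcup_(S in bitset n.+1 (n.+1 - l))
      ((fun m => (m + ascentv n S, S)) @` [set m : 'cV[nat]_n | bit_term n S m x != 0])).
    apply: bigcup_finite; first exact: finite_bitset.
    by move=> S _; apply: finite_image; apply: finite_bit_term.
  apply: sub_finite_set fin => -[m S] /= [_ hS].
  case: asboolP => [cov bt|_ /eqP//]; exists S => //.
  by exists (sub_vec n m (ascentv n S)) => //; rewrite subvK.
apply: eq_fsbigr => S _.
rewrite -(@fsbig_widen _ _ _ _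
  [set m | Cinv1 (N := n.+1) m - c \is a Num.int /\ covers n S m]).
- rewrite (reindex_fsbig (fun m => m + ascentv n S)
    [set m : 'cV[nat]_n | Cinv1 (N := n.+1) (m + ascentv n S) - c \is a Num.int]).
    apply: eq_fsbigr => m _; rewrite subv_add; case: asboolP => // ncov.
    by case: ncov => i; rewrite [X in (_ <= X)%N]mxE; apply: leq_addl.
  split.
  - move=> m /= cm; split=> // i; rewrite [X in (_ <= X)%N]mxE; exact: leq_addl.
  - by move=> m m' _ _ mm; rewrite -(subv_add n m (ascentv n S)) mm subv_add.
  - by move=> m /= [cm cov]; exists (sub_vec n m (ascentv n S)); rewrite /= subvK.
- by move=> m [].
- by move=> m /= [cm ncov]; case: asboolP => // cov; case: ncov.
Qed.

Lemma nth_bitrev (S : bitseq) (N i : nat) : size S = N -> (i < N)%N ->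
  nth false (rev S) i = nth false S (N - i.+1).
Proof. by move=> <- iN; rewrite nth_rev. Qed.

Lemma ascentv_rev (n : nat) (S : bitseq) : size S = n.+1 ->
  ascentv n (rev S) = rev_vec n (descentv n S).
Proof.
move=> sS; apply/matrixP => i j; have hi := ltn_ord i.
rewrite !mxE /ascent /descent !(nth_bitrev _ _ _ sS); try lia.
rewrite /= !subSS (_ : (n - i = (n - i.+1).+1)%N); last by lia.
by rewrite andbC.
Qed.

Lemma descentv_rev (n : nat) (S : bitseq) : size S = n.+1 ->
  descentv n (rev S) = rev_vec n (ascentv n S).
Proof.
move=> sS; apply/matrixP => i j; have hi := ltn_ord i.
rewrite !mxE /ascent /descent !(nth_bitrev _ _ _ sS); try lia.
rewrite /= !subSS (_ : (n - i = (n - i.+1).+1)%N); last by lia.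
by rewrite andbC.
Qed.

Lemma revvD (n : nat) (u v : 'cV[nat]_n) : rev_vec n u + rev_vec n v = rev_vec n (u + v).
Proof. by apply/matrixP => i j; rewrite !mxE. Qed.

Lemma revvK (n : nat) (u : 'cV[nat]_n) : rev_vec n (rev_vec n u) = u.
Proof. by apply/matrixP => i j; rewrite !mxE rev_ordK (ord1 j). Qed.

Lemma ratv_rev (n : nat) (u : 'cV[nat]_n) :
  ratv (N := n.+1) (rev_vec n u) = rev_vec n (ratv (N := n.+1) u).
Proof. by apply/matrixP => i j; rewrite !mxE. Qed.

(** Reversing both arguments swaps ascents and descents in the exponent; invariance under reversal
    and symmetry of the form restore it. *)
Lemma bit_term_rev (n : nat) (S : bitseq) (m : 'cV[nat]_n) : size S = n.+1 ->
  bit_term n (rev S) (rev_vec n m) = bit_term n S m.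
Proof.
move=> sS; rewrite /bit_term ascentv_rev// descentv_rev// !revvD !ratv_rev Cform_rev CformC.
suff -> : qpochv n (rev_vec n m) = qpochv n m by [].
rewrite /qpochv (reindex_inj rev_ord_inj); apply: eq_bigr => i _.
by rewrite mxE rev_ordK.
Qed.

(* The symmetry [c^l_m = c^l_{-m}] of the string functions. *)
Lemma fermi_class_sym (n l : nat) c c' : (l <= n)%N ->
  c + c' + l%:R / n.+1%:R \is a Num.int -> fermi_class n l c = fermi_class n l c'.
Proof.
move=> ln cc; apply/funext => x; rewrite !fermi_class_bits//.
rewrite (reindex_fsbig rev (bitset n.+1 (n.+1 - l))); last first.
  have rb S : bitset n.+1 (n.+1 - l) S -> bitset n.+1 (n.+1 - l) (rev S).
    by case=> sS cS; split; rewrite ?size_rev// count_rev.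
  split=> //; first by move=> S S' _ _; apply: (can_inj revK).
  by move=> S hS; exists (rev S); [apply: rb | rewrite revK].
apply: eq_fsbigr => S /set_mem hS; have [sS _] := hS.
rewrite (reindex_fsbig (rev_vec n)
  [set m : 'cV[nat]_n | Cinv1 (N := n.+1) (m + ascentv n S) - c' \is a Num.int]).
  by apply: eq_fsbigr => m _; rewrite bit_term_rev.
(* Reversal negates the class of [Cinv1] modulo 1, and passing from descents back to ascents costs
   [l / N]; the hypothesis on [c + c'] absorbs this. *)
have key m : (Cinv1 (N := n.+1) (rev_vec n m + ascentv n (rev S)) - c \is a Num.int) =
             (Cinv1 (N := n.+1) (m + ascentv n S) - c' \is a Num.int).
  rewrite ascentv_rev// revvD.
  have h1 := Cinv1_rev n (m + descentv n S); have h2 := Cinv1_bits n l S ln hS.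
  set A := _ - c; set B := _ - c'.
  have AB : A + B \is a Num.int.
    have -> : A + B =
      (Cinv1 (N := n.+1) (rev_vec n (m + descentv n S)) + Cinv1 (N := n.+1) (m + descentv n S))
      - (Cinv1 (N := n.+1) (descentv n S) - Cinv1 (N := n.+1) (ascentv n S) - l%:R / n.+1%:R)
      - (c + c' + l%:R / n.+1%:R) by rewrite /A /B !(Cinv1D n m); ring.
    exact: rpredB (rpredB h1 h2) cc.
  by apply/idP/idP => h; [rewrite -(addKr A B) addrC | rewrite -(addrK B A)]; apply: rpredB.
split.
- by move=> m /=; rewrite key.
- by move=> m m' _ _ /(congr1 (rev_vec n)); rewrite !revvK.
- by move=> m /= hm; exists (rev_vec n m); rewrite ?revvK// /= -key revvK.
Qed.

(** * Sums over the integers *)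

Lemma finite_int_ball (B : nat) : finite_set [set j : int | `|j| <= B%:Z].
Proof.
apply: (@sub_finite_set _ _ ((fun i : nat => i%:Z - B%:Z) @` `I_(2 * B).+1)).
  by move=> j /= jB; exists (absz (j + B%:Z)) => /=; lia.
by apply: finite_image; apply: finite_II.
Qed.

Lemma finite_quadratic_le (a b c : rat) : 0 < a ->
  forall x, finite_set [set j : int | a * j%:~R ^+ 2 + b * j%:~R + c <= x].
Proof.
move=> a0 x; set K := 1 + (`|b| + `|c - x|) / a.
apply: sub_finite_set (finite_int_ball (Num.bound `|K|)) => j /= hj.
suff jK : `|j%:~R| <= K.
  rewrite -(ler_int rat) intr_norm; apply: le_trans jK _.
  apply: le_trans (ler_norm K) _; exact: (ltW (archi_boundP (normr_ge0 K))).
rewrite leNgt; apply/negP => Kj.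
set y := j%:~R in hj Kj; have d0 : 0 <= (`|b| + `|c - x|) / a.
  by rewrite divr_ge0 ?addr_ge0// ltW.
have y1 : 1 < `|y| by apply: le_lt_trans Kj; rewrite /K; lra.
have ay : `|b| + `|c - x| < a * `|y|.
  rewrite -ltr_pdivrMl// mulrC; apply: le_lt_trans Kj; rewrite /K; lra.
have h1 : - (`|b| * `|y|) <= b * y by have := ler_norm (- (b * y)); rewrite normrN normrM; lra.
have h2 := ler_norm (- (c - x)); rewrite normrN in h2.
have h3 : y ^+ 2 = `|y| ^+ 2 by rewrite real_normK ?num_real.
have h4 : (`|b| + `|c - x|) * `|y| < a * `|y| * `|y| by rewrite ltr_pM2r//; apply: lt_trans y1.
have h5 : `|c - x| <= `|c - x| * `|y| by rewrite ler_peMr// ltW.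
by rewrite h3 in hj; lra.
Qed.

Lemma fsumID {J : choiceType} (A B : set J) (f : J -> int) :
  finite_set [set j | f j != 0] ->
  \sum_(j \in A) f j = \sum_(j \in A `&` B) f j + \sum_(j \in A `&` ~` B) f j.
Proof.
move=> fin; have supp (A' : set J) : \sum_(j \in A' `&` [set j | f j != 0]) f j = \sum_(j \in A') f j.
  by apply: fsbig_widen => [j []//|j [Aj /= nD]]; apply/eqP/negPn/negP => fj; apply: nD.
rewrite -supp (fsbigID B) ?finite_setIr//; last exact: finite_setIr.
by rewrite (setIAC A _ B) (setIAC A _ (~` B)) !supp.
Qed.

Lemma fsum_int_split (f : int -> int) : finite_set [set j | f j != 0] ->
  \sum_(j \in [set: int]) f j =
  \sum_(j \in [set j : int | 0 <= j]) f j + \sum_(j \in [set j : int | 1 <= j]) f (- j).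
Proof.
move=> fin.
have -> : \sum_(j \in [set j : int | 1 <= j]) f (- j) = \sum_(j \in ~` [set j : int | 0 <= j]) f j.
  rewrite [RHS](reindex_fsbig (fun j => - j) [set j : int | 1 <= j])//.
  split; [by move=> j /=; lia | by move=> i j _ _ /=; lia |].
  by move=> j /= /negP j0; exists (- j) => /=; [lia|rewrite opprK].
by rewrite (fsumID _ [set j : int | 0 <= j])// !setTI.
Qed.

(** The terms at [j] and [- j] stay together because alpha lists its two positive families under a
    single sum. *)
Lemma fsum_int_sym (f : int -> int) : finite_set [set j | f j != 0] ->
  \sum_(j \in [set: int]) f j = f 0 + \sum_(j \in [set j : int | 1 <= j]) (f (- j) + f j).
Proof.
move=> fin; rewrite fsum_int_split// (fsumID _ [set 0] f)//.
have -> : [set j : int | 0 <= j] `&` [set 0] = [set 0].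
  by apply/seteqP; split=> j /= => [[]|->].
have -> : [set j : int | 0 <= j] `&` ~` [set 0] = [set j : int | 1 <= j].
  by apply/seteqP; split=> j /=; [case=> ? /eqP | move=> ?; split; [|apply/eqP]]; lia.
rewrite fsbig_set1 -addrA; congr (_ + _).
have fneg : finite_set [set j : int | f (- j) != 0].
  apply: sub_finite_set (finite_image (fun j => - j) fin) => j /= fj.
  by exists (- j) => //; rewrite opprK.
transitivity (\sum_(j \in [set j : int | 1 <= j]) (f j - - f (- j))); last first.
  by apply: eq_fsbigr => j _; rewrite opprK addrC.
rewrite fsumB.
- congr (_ + _); rewrite -[LHS]mulr1 -[1]opprK mulrN mulr_fsuml.
  by congr (- _); apply: eq_fsbigr => j _; rewrite mulrN1.
- by apply: sub_finite_set fin => j [].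
- by apply: sub_finite_set fneg => j []; rewrite oppr_eq0.
Qed.

(* The unique M in [0, N] with z = M or z = - M mod 2 N. *)
Definition fold_mod (N : nat) (z : int) : nat :=
  let u := absz (z %% (2 * N)%N%:Z)%Z in if (u <= N)%N then u else (2 * N - u)%N.

Lemma fold_mod_spec (N : nat) (z : int) : (0 < N)%N ->
  (fold_mod N z <= N)%N /\
  exists q : int, z - (fold_mod N z)%:Z = q * (2 * N)%N%:Z \/
    z + (fold_mod N z)%:Z = q * (2 * N)%N%:Z.
Proof.
move=> N0; have D0 : (2 * N)%N%:Z != 0 by lia.
have zE := divz_eq z (2 * N)%N%:Z.
have u0 := modz_ge0 z D0; have u1 := ltz_mod z D0.
rewrite /fold_mod; set q := divz _ _ in zE *; set u := modz _ _ in zE u0 u1 *.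
have u2 : u < (2 * N)%N%:Z by move: u1; rewrite ger0_norm.
case: (leqP (absz u) N) => uN; split; try lia.
  by exists q; left; rewrite zE gez0_abs// addrK.
exists (q + 1); right; rewrite zE mulrDl mul1r -subzn; last by lia.
by rewrite gez0_abs//; ring.
Qed.

Lemma int_multiple_small (D q x : int) : x = q * D -> `|x| < D -> x = 0.
Proof.
move=> ->; rewrite normrM; case: (eqVneq q 0) => [->|q0]; first by move=> _; rewrite mul0r.
have q1 : 1 <= `|q| by lia.
move=> h; suff : D <= `|q| * `|D| by lia.
by apply: le_trans (ler_norm D) _; rewrite ler_peMl.
Qed.

Lemma fold_mod_uniq (N M : nat) (z : int) : (0 < N)%N -> (M <= N)%N ->
  (exists q : int, z - M%:Z = q * (2 * N)%N%:Z \/ z + M%:Z = q * (2 * N)%N%:Z) ->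
  fold_mod N z = M.
Proof.
move=> N0 MN [q hq]; have [fN [q' hq']] := fold_mod_spec N z N0.
move: (fold_mod N z) fN hq' => F fN hq'.
have diff : (exists c, F%:Z - M%:Z = c * (2 * N)%N%:Z) -> F = M.
  case=> c hc; have : F%:Z - M%:Z = 0 by apply: int_multiple_small hc _; lia.
  lia.
(* A multiple of [2 N] between 0 and [2 N] is an end point: either both numbers are 0 or both are
   [N]. *)
have sum : (exists c, F%:Z + M%:Z = c * (2 * N)%N%:Z) -> F = M.
  case=> c hc; have [FM|FM] := ltnP (F + M) (2 * N).
    have : F%:Z + M%:Z = 0 by apply: int_multiple_small hc _; lia.
    lia.
  lia.
case: hq hq' => h [] h'.
- by apply: diff; exists (q - q'); rewrite mulrBl -h -h'; ring.
- by apply: sum; exists (q' - q); rewrite mulrBl -h -h'; ring.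
- by apply: sum; exists (q - q'); rewrite mulrBl -h -h'; ring.
- by apply: diff; exists (q' - q); rewrite mulrBl -h -h'; ring.
Qed.

Lemma odd_fold_mod (N l : nat) (z : int) : (0 < N)%N -> (exists y : int, z = l%:Z + 2 * y) ->
  odd (fold_mod N z) = odd l.
Proof.
move=> N0 [y hy]; have [_ [q]] := fold_mod_spec N z N0; rewrite hy.
have -> : q * (2 * N)%N%:Z = 2 * (q * N%:Z) by rewrite PoszM; ring.
move: (fold_mod _ _) (q * _) => F c h.
have [d] : exists d : int, F%:Z = l%:Z + 2 * d.
  by case: h => h; [exists (y - c) | exists (c - y - l%:Z)]; lia.
lia.
Qed.

Lemma int_divP (z : int) (d : nat) : (0 < d)%N ->
  reflect (exists q : int, z = q * d%:Z) (z%:~R / d%:R \is a @Num.int rat).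
Proof.
move=> d0; have dn0 : d%:R != 0 :> rat by rewrite pnatr_eq0 -lt0n.
apply: (iffP idP) => [/intrP[q hq]|[q ->]].
  exists q; apply/eqP; rewrite -(eqr_int rat) rmorphM /= -hq.
  by rewrite pmulrn divfK.
by rewrite rmorphM /= pmulrn mulfK// intr_int.
Qed.

Lemma fermi_class_eq (n l : nat) c c' : c - c' \is a Num.int ->
  fermi_class n l c = fermi_class n l c'.
Proof.
move=> cc; congr qsum; apply/seteqP; split=> m /= h.
  by have := rpredD h cc; rewrite addrA subrK.
by have := rpredB h cc; rewrite opprB addrA subrK.
Qed.

(** * The sequence alpha *)

(* The positions L of the positive (pos1) and negative (pos2) terms of alpha: the
   two families of each sign are indexed jointly by the integers, one of them by
   - j, and the initial term is j = 0 of the positive ones. *)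
Definition pos1 (p' b s : nat) (j : int) : nat :=
  let z : int := 2 * (j * p'%:Z) + s%:Z - b%:Z in let d : int := b%:Z - s%:Z in
  half (subn (absz z) (absz d)).

Definition pos2 (p' b s : nat) (j : int) : nat :=
  let z : int := 2 * (j * p'%:Z) + s%:Z + b%:Z in let d : int := b%:Z - s%:Z in
  half (subn (absz z) (absz d)).

(** These bounds let the product be treated as an atom in linear arithmetic. *)
Lemma mul_int_cases (j : int) (q : nat) :
  [\/ j = 0 /\ j * q%:Z = 0, 1 <= j /\ q%:Z <= j * q%:Z | j <= -1 /\ j * q%:Z <= - q%:Z].
Proof.
have [j0|[j0|j0]] : j = 0 \/ 1 <= j \/ j <= -1 by lia.
- by constructor 1; rewrite j0 mul0r.
- by constructor 2; split=> //; nia.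
- by constructor 3; split=> //; nia.
Qed.

(** Since [b] and [s] lie strictly between 0 and [p'], the right side is at least [|b - s|] and has
    its parity. Hence the truncated subtraction and the halving are exact; the same holds in
    [pos2E]. *)
Lemma pos1E (p' b s : nat) (j : int) : (1 <= b <= p' - 1)%N -> (1 <= s <= p' - 1)%N ->
  2 * (pos1 p' b s j)%:Z + `|b%:Z - s%:Z| = `|2 * (j * p'%:Z) + s%:Z - b%:Z|.
Proof.
move=> hb hs; rewrite /pos1; have := mul_int_cases j p'; move: (j * p'%:Z) => X.
by case=> [] [hj hX]; lia.
Qed.

Lemma pos2E (p' b s : nat) (j : int) : (1 <= b <= p' - 1)%N -> (1 <= s <= p' - 1)%N ->
  2 * (pos2 p' b s j)%:Z + `|b%:Z - s%:Z| = `|2 * (j * p'%:Z) + s%:Z + b%:Z|.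
Proof.
move=> hb hs; rewrite /pos2; have := mul_int_cases j p'; move: (j * p'%:Z) => X.
by case=> [] [hj hX]; lia.
Qed.

Lemma finite_fiber (p' : nat) (d lam : int) (h : int -> nat) (L : nat) : (0 < p')%N ->
  (forall j, 2 * (h j)%:Z + lam = `|2 * (j * p'%:Z) + d|) -> finite_set [set j | h j = L].
Proof.
move=> p0 hE; apply: sub_finite_set (finite_int_ball (2 * L + absz lam + absz d)) => j /= hj.
have hjE := hE j; rewrite hj in hjE.
have : `|j| <= `|j * p'%:Z| by rewrite normrM; nia.
move: (j * p'%:Z) hjE => X; lia.
Qed.

Lemma delta_nat (a c : nat) : delta a%:R c%:R = (c == a)%:R.
Proof. by rewrite /delta eqr_nat eq_sym. Qed.

Lemma fiber_sum (h : int -> nat) (e : int -> rat) (L : nat) y :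
  qsum [set j | h j = L] (fun j => qmon 1 (e j)) y =
  \sum_(j \in [set: int]) qmon (delta L%:R (h j)%:R) (e j) y.
Proof.
rewrite /qsum fsbig_mkcond; apply: eq_fsbigr => j _.
rewrite /patch delta_nat !qmonE.
have -> : (j \in [set j | h j = L]) = (h j == L).
  by apply/idP/eqP => [/set_mem//|hj]; apply/mem_set.
by case: (h j == L) => /=; case: ifP.
Qed.

Lemma fiber_support (h : int -> nat) (e : int -> rat) (L : nat) y :
  finite_set [set j | h j = L] ->
  finite_set [set j | qmon (delta L%:R (h j)%:R) (e j) y != 0].
Proof.
apply: sub_finite_set => j; rewrite /= delta_nat qmonE.
by case: (h j =P L) => //= _; case: ifP.
Qed.

Lemma pos_rat (a : nat) (c e : int) : 2 * a%:Z = 2 * c - e ->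
  c%:~R - e%:~R / 2 = a%:R :> rat.
Proof.
move=> /(congr1 (fun z : int => z%:~R : rat)); rewrite rmorphB !rmorphM /=.
by rewrite -[a%:~R]/(a%:R); lra.
Qed.

(** At [j >= 1] this is the exponent of the second positive family of alpha, and at [- j] that of
    the first. *)
Definition alpha_exp1 (p p' r b s k : nat) (j : int) : int :=
  let w : int := k%:Z * p'%:Z + p'%:Z - p%:Z in let t : int := k%:Z * b%:Z + b%:Z - r%:Z in
  j * (j * p'%:Z * w - p'%:Z * t + s%:Z * w).

Definition alpha_exp2 (p p' r b s k : nat) (j : int) : int :=
  let w : int := k%:Z * p'%:Z + p'%:Z - p%:Z in let t : int := k%:Z * b%:Z + b%:Z - r%:Z in
  (j * p'%:Z + s%:Z) * (j * w + t).

Lemma alphaE (p p' r b s k L : nat) : (1 <= b <= p' - 1)%N -> (1 <= s <= p' - 1)%N ->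
  alpha p p' r b s k L =
  qsum [set j | pos1 p' b s j = L] (fun j => qmon 1 (alpha_exp1 p p' r b s k j)%:~R) \-
  qsum [set j | pos2 p' b s j = L] (fun j => qmon 1 (alpha_exp2 p p' r b s k j)%:~R).
Proof.
move=> hb hs; pose w : int := k%:Z * p'%:Z + p'%:Z - p%:Z.
pose t : int := k%:Z * b%:Z + b%:Z - r%:Z.
have p0 : (0 < p')%N by lia.
have fin1 : finite_set [set j | pos1 p' b s j = L].
  by apply: (@finite_fiber p' (s%:Z - b%:Z) `|b%:Z - s%:Z|) => // j; rewrite pos1E// addrA.
have fin2 : finite_set [set j | pos2 p' b s j = L].
  by apply: (@finite_fiber p' (s%:Z + b%:Z) `|b%:Z - s%:Z|) => // j; rewrite pos2E// addrA.
apply/funext => y; rewrite /alpha -/w -/t /= !fiber_sum.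
rewrite [X in _ = X - _]fsum_int_sym; last exact: fiber_support.
rewrite [X in _ = _ - X]fsum_int_split; last exact: fiber_support.
have reg (x1 x2 x3 x4 : int) : x1 + x2 - (x3 + x4) = x1 + x2 - x3 - x4 by ring.
rewrite {}reg; congr (_ + _ - _ - _).
- rewrite /alpha_exp1 /= mul0r (_ : pos1 p' b s 0 = 0%N)//.
  by have := pos1E p' b s 0 hb hs; rewrite mul0r mulr0; lia.
- apply: eq_fsbigr => j /set_mem /= j1; have jp : p'%:Z <= j * p'%:Z by nia.
  have h1 := pos1E p' b s j hb hs; have h2 := pos1E p' b s (- j) hb hs.
  rewrite mulNr in h2.
  congr (qmon (delta _ _) _ _ + qmon (delta _ _) _ _).
  + by apply: pos_rat; move: (j * p'%:Z) jp h1 h2 => X jp h1 h2; lia.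
  + by congr (_%:~R); rewrite /alpha_exp1 /w /t /=; ring.
  + by apply: pos_rat; move: (j * p'%:Z) jp h1 h2 => X jp h1 h2; lia.
- apply: eq_fsbigr => j /set_mem /= j1; have jp : 0 <= j * p'%:Z by nia.
  have h1 := pos2E p' b s j hb hs.
  congr (qmon (delta _ _) _ _).
  by apply: pos_rat; move: (j * p'%:Z) jp h1 => X jp h1; lia.
- apply: eq_fsbigr => j /set_mem /= j1; have jp : p'%:Z <= j * p'%:Z by nia.
  have h1 := pos2E p' b s (- j) hb hs; rewrite mulNr in h1.
  congr (qmon (delta _ _) _ _).
  + by apply: pos_rat; move: (j * p'%:Z) jp h1 => X jp h1; lia.
  + by congr (_%:~R); rewrite /alpha_exp2 /w /t /=; ring.
Qed.

(** * The branching functions *)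

Lemma q_of_ps_ge0 a x : q_of_ps a x != 0 -> 0 <= x.
Proof. by case/q_of_ps_neq0 => k ->; apply: ler0n. Qed.

Lemma stringf_class (n l : nat) (M : int) : stringf n.+1 l M =
  qmul (qmon 1 ((l * (n.+1 - l))%N%:R / (2 * n.+1 * (n.+1 + 2))%N%:R))
    (qmul inv_qpoch_oo (fermi_class n l (- ((M + l%:Z)%:~R / (2 * n.+1)%N%:R)))).
Proof.
rewrite /stringf /fermi_class; set q := (M + l%:Z)%:~R / _.
have -> // : [set m : 'cV[nat]_(n.+1.-1) | q + Cinv1 m \is a Num.int] =
  [set m | Cinv1 m - - q \is a Num.int].
by apply/funext => m; rewrite /mkset opprK [q + _]addrC.
Qed.

Lemma eqmodN_half (N : nat) (z M : int) : (0 < N)%N ->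
  eqmodN N (z%:~R / 2) (M%:~R / 2) = ((z - M)%:~R / (2 * N)%N%:R \is a @Num.int rat).
Proof.
move=> N0; have N1 : N%:R != 0 :> rat by rewrite pnatr_eq0 -lt0n.
have -> // : (z - M)%:~R / (2 * N)%N%:R = (z%:~R / 2 - M%:~R / 2) / N%:R :> rat.
by rewrite natrM rmorphB /=; field.
Qed.

(** Doubling turns congruence to [M / 2] up to sign modulo [N] into congruence to [M] up to sign
    modulo [2 N], which [fold_mod] decides. *)
Lemma congruent_fold_mod (N M : nat) (a P' : int) : (0 < N)%N -> (M <= N)%N ->
  [set j : int | eqmodN N (a%:~R / 2 + (P' * j)%:~R) (M%:R / 2) \/
                 eqmodN N (a%:~R / 2 + (P' * j)%:~R) (- (M%:R / 2))] =
  [set j | fold_mod N (a + 2 * (P' * j)) = M].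
Proof.
move=> N0 MN; apply/seteqP.
have N2 : (0 < 2 * N)%N by lia.
have muE j : a%:~R / 2 + (P' * j)%:~R = (a + 2 * (P' * j))%:~R / 2 :> rat.
  by rewrite rmorphD (rmorphM _ 2) /=; field.
have MR : M%:R = (M%:Z)%:~R :> rat by [].
have MR' : - (M%:R / 2) = (- M%:Z)%:~R / 2 :> rat by rewrite rmorphN mulNr.
split=> j /=; rewrite muE MR' MR !eqmodN_half//.
  move=> h; apply: fold_mod_uniq => //.
  by case: h => /int_divP-/(_ N2)[q hq]; exists q; [left|right; rewrite -[M%:Z]opprK].
move=> h; have [_ [q]] := fold_mod_spec N (a + 2 * (P' * j)) N0.
rewrite h => -[] hq; [left|right]; apply/int_divP => //; exists q => //.
by rewrite opprK.
Qed.

(** With [F] the folded value of [z], [y] is [F] or [- F] modulo [2 N]. In the case [- F] the two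
    classes coincide; in the case [F] they are exchanged by the symmetry of the string functions. *)
Lemma fermi_class_fold_mod (n l : nat) (y z : int) : (l <= n)%N ->
  (exists q : int, y - z = q * (2 * n.+1)%N%:Z \/ y + z = q * (2 * n.+1)%N%:Z) ->
  fermi_class n l ((y - l%:Z)%:~R / (2 * n.+1)%N%:R) =
  fermi_class n l (- (((fold_mod n.+1 z)%:Z + l%:Z)%:~R / (2 * n.+1)%N%:R)).
Proof.
move=> ln [q hq]; have [_ [q']] := fold_mod_spec n.+1 z isT.
move: (fold_mod _ _) => F hq'.
have n0 : (0 < 2 * n.+1)%N by [].
have n1 : n.+1%:R != 0 :> rat by rewrite pnatr_eq0.
have [[c hc]|[c hc]] : (exists c, y - F%:Z = c * (2 * n.+1)%N%:Z) \/
                       (exists c, y + F%:Z = c * (2 * n.+1)%N%:Z).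
  case: hq hq' => h [] h'.
  - by left; exists (q + q'); rewrite mulrDl -h -h'; ring.
  - by right; exists (q + q'); rewrite mulrDl -h -h'; ring.
  - by right; exists (q - q'); rewrite mulrBl -h -h'; ring.
  - by left; exists (q - q'); rewrite mulrBl -h -h'; ring.
- apply: fermi_class_sym => //.
  rewrite (_ : _ + _ = (y - F%:Z)%:~R / (2 * n.+1)%N%:R); first by apply/int_divP => //; exists c.
  by rewrite natrM !(rmorphD, rmorphB) /=; move: n1; move: (n.+1%:R) => nn n1; field.
- apply: fermi_class_eq.
  rewrite (_ : _ - _ = (y + F%:Z)%:~R / (2 * n.+1)%N%:R); first by apply/int_divP => //; exists c.
  by rewrite natrM !(rmorphD, rmorphB) /=; move: n1; move: (n.+1%:R) => nn n1; field.
Qed.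

Lemma locally_finite_inv_qpoch_oo : locally_finite inv_qpoch_oo.
Proof. exact: locally_finite_q_of_ps. Qed.

Definition theta1 (N : nat) (P P' R S j : int) : rat :=
  j%:~R / N%:R * (j * P * P' + P' * R - P * S)%:~R.

Definition theta2 (N : nat) (P P' R S j : int) : rat :=
  N%:R^-1 * ((j * P' + S) * (j * P + R))%:~R.

Lemma finite_int_quadratic_le (a b c : int) (N : nat) (e : int -> rat) : 0 < a -> (0 < N)%N ->
  (forall j, e j = (a%:~R * j%:~R ^+ 2 + b%:~R * j%:~R + c%:~R) / N%:R) ->
  forall x, finite_set [set j | e j <= x].
Proof.
move=> a0 N0 eE x.
have := @finite_quadratic_le (a%:~R / N%:R) (b%:~R / N%:R) (c%:~R / N%:R) _ x.
rewrite divr_gt0 ?ltr0z ?ltr0n// => /(_ isT); apply: sub_finite_set => j /=.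
by rewrite eE !mulrDl mulrAC [b%:~R * _ / _]mulrAC.
Qed.

Lemma finite_theta1 (N : nat) (P P' R S : int) : (0 < N)%N -> 0 < P -> 0 < P' ->
  forall x, finite_set [set j | theta1 N P P' R S j <= x].
Proof.
move=> N0 P0 P'0; apply: (@finite_int_quadratic_le (P * P') (P' * R - P * S) 0 N) => //.
  exact: mulr_gt0.
by move=> j; rewrite /theta1 !(rmorphD, rmorphB, rmorphM) /=; ring.
Qed.

Lemma finite_theta2 (N : nat) (P P' R S : int) : (0 < N)%N -> 0 < P -> 0 < P' ->
  forall x, finite_set [set j | theta2 N P P' R S j <= x].
Proof.
move=> N0 P0 P'0; apply: (@finite_int_quadratic_le (P * P') (P' * R + P * S) (S * R) N) => //.
  exact: mulr_gt0.
by move=> j; rewrite /theta2 !(rmorphD, rmorphB, rmorphM) /=; ring.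
Qed.

(** The normalizing power cancels the prefactor of the string functions. Every [j] has one folded
    index, of the parity of [l], so the sum over [M] collapses. *)
Lemma branchingE (n l : nat) (P P' R' S' : int) (ln : (l <= n)%N) :
  let G (z : int) := qmul inv_qpoch_oo
    (fermi_class n l (- (((fold_mod n.+1 z)%:Z + l%:Z)%:~R / (2 * n.+1)%N%:R))) in
  0 < P -> 0 < P' -> (exists y : int, R' - S' = l%:Z + 2 * y) ->
  branching P P' n.+1 R' S' l =
  qsum [set: int] (fun j => qmul (qmon 1 (theta1 n.+1 P P' R' S' j)) (G (R' - S' + 2 * (P' * j)))) \-
  qsum [set: int] (fun j => qmul (qmon 1 (theta2 n.+1 P P' R' S' j)) (G (R' + S' + 2 * (P' * j)))).
Proof.
move=> G P0 P'0 [y hy].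
set h1 := fun j : int => fold_mod n.+1 (R' - S' + 2 * (P' * j)).
set h2 := fun j : int => fold_mod n.+1 (R' + S' + 2 * (P' * j)).
pose GM (M : nat) := qmul inv_qpoch_oo
    (fermi_class n l (- ((M%:Z + l%:Z)%:~R / (2 * n.+1)%N%:R))).
have fe1 := finite_theta1 n.+1 P P' R' S' isT P0 P'0.
have fe2 := finite_theta2 n.+1 P P' R' S' isT P0 P'0.
set e1 := theta1 n.+1 P P' R' S' in fe1 *; set e2 := theta2 n.+1 P P' R' S' in fe2 *.
rewrite /branching.
pose A : set nat := [set M : nat | (M <= n.+1)%N /\ odd M = odd l].
transitivity (qsum A (fun M => qmul (GM M)
    (qsum [set j | h1 j = M] (fun j => qmon 1 (e1 j)) \-
     qsum [set j | h2 j = M] (fun j => qmon 1 (e2 j))))).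
  apply/funext => x; rewrite qmul_qmon mul1r opprK /qsum.
  apply: eq_fsbigr => M /set_mem [MN oM].
  by rewrite !congruent_fold_mod// stringf_class qmul_qmonA qmul_qmon mul1r addrK.
have GM0 M x : GM M x != 0 -> 0 <= x.
  by case/qmul_neq0 => u /q_of_ps_ge0 u0 /fermi_class_ge0; lra.
have lGM M : locally_finite (GM M) 
  by apply: locally_finite_qmul; [apply: locally_finite_inv_qpoch_oo | apply: locally_finite_fermi_class].
rewrite (@qsum_fibers_qmon nat int A h1 h2 e1 e2 GM lGM GM0 fe1 fe2)//.
- move=> j; split; first by have [] := fold_mod_spec n.+1 (R' - S' + 2 * (P' * j)) isT.
  by apply: odd_fold_mod => //; exists (y + P' * j); rewrite hy; ring.
- move=> j; split; first by have [] := fold_mod_spec n.+1 (R' + S' + 2 * (P' * j)) isT.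
  by apply: odd_fold_mod => //; exists (y + S' + P' * j); rewrite mulrDr mulrDr addrA addrA -hy; ring.
Qed.

(** * The Bailey flow *)

Lemma qmul_theta (g : qseries) (h1 h2 : int -> nat) (e1 e2 : int -> rat) (F : nat -> qseries) :
  locally_finite g -> (forall L, locally_finite (F L)) -> (forall L x, F L x != 0 -> 0 <= x) ->
  (forall x, finite_set [set j | e1 j <= x]) -> (forall x, finite_set [set j | e2 j <= x]) ->
  qmul g (qsum [set: nat] (fun L => qmul (F L)
    (qsum [set j | h1 j = L] (fun j => qmon 1 (e1 j)) \-
     qsum [set j | h2 j = L] (fun j => qmon 1 (e2 j))))) =
  qsum [set: int] (fun j => qmul (qmon 1 (e1 j)) (qmul g (F (h1 j)))) \-
  qsum [set: int] (fun j => qmul (qmon 1 (e2 j)) (qmul g (F (h2 j)))).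
Proof.
move=> lg lF F0 f1 f2; rewrite (@qsum_fibers_qmon nat int _ h1 h2 e1 e2 F)//.
have s1 := summable_shift h1 e1 F lF F0 f1; have s2 := summable_shift h2 e2 F lF F0 f2.
rewrite qmulBr//; [|exact: locally_finite_qsum..].
rewrite !qmul_qsum//; apply/funext => x; rewrite /= /qsum.
by congr (_ - _); apply: eq_fsbigr => j _; rewrite qmul_qmonCA.
Qed.

(** The integrality condition is negated and put over the denominator [2 N], to expose the integer
    compared later with the argument of [fold_mod]. *)
Lemma fermi_class_sum (n l L sigma : nat) (lam : int) :
  qsum [set eta : 'cV[nat]_(n.+1.-1) |
    (L%:R + (lam - l%:Z)%:~R / 2) / n.+1%:R - Cinv1 eta - sigma%:R / 2 \is a Num.int]
    (fermi_term (N := n.+1) l) =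
  fermi_class n l ((2 * L%:Z + lam - n.+1%:Z * sigma%:Z - l%:Z)%:~R / (2 * n.+1)%N%:R).
Proof.
have nn1 : n.+1%:R != 0 :> rat by rewrite pnatr_eq0.
rewrite /fermi_class; set A := [set eta | _]; set B := [set m | _].
have -> // : A = B; apply/funext => m; rewrite /A /B /mkset -rpredN.
have -> // : - ((L%:R + (lam - l%:Z)%:~R / 2) / n.+1%:R - Cinv1 m - sigma%:R / 2) =
  Cinv1 m - (2 * L%:Z + lam - n.+1%:Z * sigma%:Z - l%:Z)%:~R / (2 * n.+1)%N%:R :> rat.
rewrite natrM !(rmorphD, rmorphB, rmorphM, rmorphN) /=.
rewrite -[n.+1%:~R]/(n.+1%:R) -[sigma%:~R]/(sigma%:R) -[L%:~R]/(L%:R).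
by move: nn1; move: (n.+1%:R) => nn nn1; field.
Qed.

(** Completing the square, [4 L (L + lam) = (2 L + lam)^2 - lam^2]. *)
Lemma square_pos (L lam z d : int) : 2 * L + lam = `|z| -> lam = `|d| ->
  4 * (L * (L + lam)) = z ^+ 2 - d ^+ 2.
Proof.
move=> hz hl; rewrite -[z ^+ 2]real_normK ?num_real// -[d ^+ 2]real_normK ?num_real//.
by rewrite -hz -hl; ring.
Qed.

Lemma qmul_qmonB e f g : qmul (qmon 1 e) (f \- g) = qmul (qmon 1 e) f \- qmul (qmon 1 e) g.
Proof. by apply/funext => x; rewrite /= !qmul_qmon mulrBr. Qed.

Lemma qmul_qmon_qsum (e : rat) (A : set int) (f g : int -> rat) :
  (forall j, A j -> g j = f j + e) ->
  qmul (qmon 1 e) (qsum A (fun j => qmon 1 (f j))) = qsum A (fun j => qmon 1 (g j)).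
Proof.
move=> fg; apply/funext => y; rewrite qmul_qmon mul1r; apply: eq_fsbigr => j /set_mem/fg gj.
by rewrite !qmonE subr_eq gj.
Qed.

Theorem mainTheorem2 (p p' r b s N k l sigma : nat) :
  (1 <= p)%N -> (p < p')%N -> coprime p p' ->
  (1 <= r <= p - 1)%N -> (1 <= b <= p' - 1)%N -> (1 <= s <= p' - 1)%N ->
  (1 <= N)%N -> (l < N)%N ->
  let lambda : int := `|b%:Z - s%:Z| in
  let t : int := k%:Z * b%:Z + b%:Z - r%:Z in
  (2 %| l%:Z + lambda + N%:Z * t)%Z ->
  (sigma < 2)%N -> (sigma%:Z = t %[mod 2])%Z ->
  qmul inv_qpoch_oo
    (qsum [set: nat] (fun L =>
      qmul (qmul (qmon 1 (L%:R * (L%:R + lambda%:~R) / N%:R))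
                 (alpha p p' r b s k L))
        (qsum [set eta : 'cV[nat]_(N.-1) |
                 (L%:R + (lambda - l%:Z)%:~R / 2) / N%:R - Cinv1 eta
                   - sigma%:R / 2 \is a Num.int]
              (@fermi_term N l))))
  = branching p'%:Z (p'%:Z + N%:Z * (k%:Z * p'%:Z + p'%:Z - p%:Z)) N
      s%:Z (b%:Z + N%:Z * t) l.
Proof.
move=> p1 pp' _ hr hb hs; case: N => [//|n] _; rewrite ltnS => ln lam t hpar hsig ht.
pose w : int := k%:Z * p'%:Z + p'%:Z - p%:Z; rewrite -/w.
have w0 : 0 <= w by rewrite /w; nia.
have [u hu] : exists u : int, l%:Z + lam + n.+1%:Z * t = 2 * u.
  by case/dvdzP: hpar => u ->; exists u; rewrite mulrC.
have [v hv] : exists v : int, sigma%:Z - t = 2 * v.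
  by exists ((sigma%:Z - t) %/ 2)%Z; move: ht; move: t {hpar hu} => t; lia.
set P' := p'%:Z + n.+1%:Z * w.
have P0 : 0 < p'%:Z by lia.
have P'0 : 0 < P' by rewrite /P' ltr_wpDr// mulr_ge0.
have nn1 : n.+1%:R != 0 :> rat by rewrite pnatr_eq0.
(* The parity required here is [s - S' = l] modulo 2; it follows from the parity hypothesis, as
   [s - b] and [|b - s|] have the same parity. *)
rewrite branchingE//; last first.
  have : exists c : int, s%:Z - b%:Z = lam + 2 * c.
    have [sb|sb] := leP s%:Z b%:Z; first by exists (s%:Z - b%:Z); rewrite /lam; lia.
    by exists 0; rewrite /lam; lia.
  case=> c hc; exists (c - l%:Z - n.+1%:Z * t + u).
  by rewrite opprD addrA hc; move: hu; move: (n.+1%:Z * t) => X; lia.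
set S' := b%:Z + n.+1%:Z * t.
pose F (L : nat) :=
  fermi_class n l ((2 * L%:Z + lam - n.+1%:Z * sigma%:Z - l%:Z)%:~R / (2 * n.+1)%N%:R).
have h1 j := pos1E p' b s j hb hs; have h2 j := pos2E p' b s j hb hs.
transitivity (qmul inv_qpoch_oo (qsum [set: nat] (fun L => qmul (F L)
    (qsum [set j | pos1 p' b s j = L] (fun j => qmon 1 (theta1 n.+1 p' P' s S' j)) \-
     qsum [set j | pos2 p' b s j = L] (fun j => qmon 1 (theta2 n.+1 p' P' s S' j)))))).
  congr (qmul _ (qsum _ _)); apply/funext => L.
  rewrite fermi_class_sum qmulC; apply: (congr1 (qmul (F L))).
  rewrite alphaE// qmul_qmonB; congr (_ \- _); apply: qmul_qmon_qsum => j /= hj.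
  (* With [z = 2 j p' + s - b] and [d = b - s], [(z^2 - d^2) / 4] factors. Divided by [N], it is the
     part of [theta1] free of [w] and [t]; the exponent of alpha is the rest. *)
  - have hL : L%:Z * (L%:Z + lam) = (j * p'%:Z) * (j * p'%:Z + s%:Z - b%:Z).
      have hz := h1 j; rewrite hj in hz.
      have := square_pos _ _ _ (b%:Z - s%:Z) hz erefl; rewrite -/lam.
      move: (L%:Z * _) => Y hY; have : 4 * Y = 4 * (j * p'%:Z * (j * p'%:Z + s%:Z - b%:Z)).
        by rewrite hY; ring.
      by move: (j * p'%:Z * _) => Z; lia.
    have {}hL : L%:R * (L%:R + lam%:~R) = ((j * p'%:Z) * (j * p'%:Z + s%:Z - b%:Z))%:~R :> rat.
      by rewrite -hL rmorphM rmorphD.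
    rewrite hL /theta1 /alpha_exp1 /= -/w -/t /S' /P'.
    rewrite !(rmorphD, rmorphN, rmorphM) /= -[n.+1%:~R]/(n.+1%:R).
    by move: nn1; move: (n.+1%:R) => nn nn1; field.
  - have hL : L%:Z * (L%:Z + lam) = (j * p'%:Z + s%:Z) * (j * p'%:Z + b%:Z).
      have hz := h2 j; rewrite hj in hz.
      have := square_pos _ _ _ (b%:Z - s%:Z) hz erefl; rewrite -/lam.
      move: (L%:Z * _) => Y hY; have : 4 * Y = 4 * ((j * p'%:Z + s%:Z) * (j * p'%:Z + b%:Z)).
        by rewrite hY; ring.
      by move: ((j * p'%:Z + s%:Z) * _) => Z; lia.
    have {}hL : L%:R * (L%:R + lam%:~R) = ((j * p'%:Z + s%:Z) * (j * p'%:Z + b%:Z))%:~R :> rat.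
      by rewrite -hL rmorphM rmorphD.
    rewrite hL /theta2 /alpha_exp2 /= -/w -/t /S' /P'.
    rewrite !(rmorphD, rmorphN, rmorphM) /= -[n.+1%:~R]/(n.+1%:R).
    by move: nn1; move: (n.+1%:R) => nn nn1; field.
have lF L : locally_finite (F L) by apply: locally_finite_fermi_class.
have F0 L x : F L x != 0 -> 0 <= x by apply: fermi_class_ge0.
rewrite (qmul_theta _ _ _ _ _ F locally_finite_inv_qpoch_oo lF F0
  (finite_theta1 n.+1 _ _ s S' isT P0 P'0)
  (finite_theta2 n.+1 _ _ s S' isT P0 P'0)).
apply/funext => x; rewrite /= /qsum; congr (_ - _); apply: eq_fsbigr => j _.
(* With [z = 2 j p' + s - b], the branching side folds [z - N t + 2 N w j], while the fermionic side
   has [|z| - N sigma]. As [sigma - t = 2 v], they agree modulo [2 N] up to a sign, which is the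
   sign of [z]. *)
- rewrite -(fermi_class_fold_mod n l (2 * (pos1 p' b s j)%:Z + lam - n.+1%:Z * sigma%:Z) _ ln) //.
  rewrite h1 PoszM /S' /P'; have [z0|z0] := ger0P (2 * (j * p'%:Z) + s%:Z - b%:Z).
    by exists (- v - w * j); left; rewrite (_ : sigma%:Z = t + 2 * v); [ring | rewrite -hv; ring].
  by exists (w * j - v - t); right; rewrite (_ : sigma%:Z = t + 2 * v); [ring | rewrite -hv; ring].
(* The same comparison with [z = 2 j p' + s + b] and [+ N t] in place of [- N t]. *)
- rewrite -(fermi_class_fold_mod n l (2 * (pos2 p' b s j)%:Z + lam - n.+1%:Z * sigma%:Z) _ ln) //.
  rewrite h2 PoszM /S' /P'; have [z0|z0] := ger0P (2 * (j * p'%:Z) + s%:Z + b%:Z).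
    by exists (- v - t - w * j); left; rewrite (_ : sigma%:Z = t + 2 * v); [ring | rewrite -hv; ring].
  by exists (w * j - v); right; rewrite (_ : sigma%:Z = t + 2 * v); [ring | rewrite -hv; ring].
Qed.
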